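(* Let $f:\mathbb{R}^n\to\mathbb{R}$ be $L$-smooth and $\mu$-strongly convex with $\mu>0$, and let $\mathcal{P}\subseteq\mathbb{R}^{n\times n}$ be a closed convex set with $0\in\mathcal{P}$, $L^{-1}I\in\mathcal{P}$ and $\mathrm{diam}(\mathcal{P})\le D$, $D>0$. For $K\ge1$ run OSGM-R from $x^1\in\mathbb{R}^n$, $P_1\in\mathcal{P}$ with stepsize $\eta=\min\big\{\tfrac{1}{4L^2},\tfrac{D}{2L(1+LD)\sqrt{K}}\big\}$ for $K$ iterations. Then: (i) if $x^1,\dots,x^K$ are not minimizers of $f$, then $\theta_K^\star:=\min_{P\in\mathcal{P}}\frac1K\sum_{k=1}^Kr_{x^k}(P)\le 1-\frac1{\kappa^\star}$, where $\kappa^\star$ is the optimal condition number with respect to $\mathcal{P}_+$; (ii) the asymptotic complexity of finding an $\varepsilon$-optimal point is $\mathcal{O}(\kappa^\star\log(1/\varepsilon))$: there is an absolute constant $C>0$ such that for every choice of constants $L,\mu,D>0$, every twice differentiable, $L$-smooth and $\mu$-strongly convex function $f:\mathbb{R}^n\to\mathbb{R}$ (in any dimension $n\ge1$), every closed convex set $\mathcal{P}\subseteq\mathbb{R}^{n\times n}$ with $0\in\mathcal{P}$, $L^{-1}I\in\mathcal{P}$ and $\mathrm{diam}(\mathcal{P})\le D$, every $x^1\in\mathbb{R}^n$ and every $P_1\in\mathcal{P}$, there exists $\varepsilon_0\in(0,1)$ such that for all $\varepsilon\in(0,\varepsilon_0)$ and all integers $K\ge C\kappa^\star\log(1/\varepsilon)$,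 the run of OSGM-R with horizon $K$ (that is, from $x^1,P_1$ for $K$ iterations with stepsize $\eta=\min\big\{\tfrac{1}{4L^2},\tfrac{D}{2L(1+LD)\sqrt{K}}\big\}$) generates an iterate $x^k$, $1\le k\le K+1$, with $f(x^k)\le f(x^\star)+\varepsilon$.
   Context: Norms: $\|\cdot\|$ is the Euclidean norm of vectors and the spectral norm of matrices; $\|\cdot\|_F$ is the Frobenius norm; $\mathrm{diam}(\mathcal{P})=\sup_{P,Q\in\mathcal{P}}\|P-Q\|_F$. Assumptions on $f$: $f$ is twice differentiable; $L$-smooth means $|f(x)-f(y)-\langle\nabla f(y),x-y\rangle|\le\frac L2\|x-y\|^2$ for all $x,y$; $\mu$-strongly convex means $f(x)-f(y)-\langle\nabla f(y),x-y\rangle\ge\frac\mu2\|x-y\|^2$ for all $x,y$. $x^\star$ is the minimizer of $f$. Optimal condition number: $\mathcal{P}_+=\mathcal{P}\cap\mathbb{S}^n_+$ (positive semidefinite elements of $\mathcal{P}$), and $\kappa^\star$ is the minimum of $\kappa>0$ over $P\in\mathcal{P}_+$ subject to $\frac1\kappa I\preceq P^{1/2}\nabla^2f(x)P^{1/2}\preceq I$ for all $x\in\mathbb{R}^n$. Ratio surrogate: for $x$ not a minimizer and $P\in\mathbb{R}^{n\times n}$, $r_x(P):=\dfrac{f(x-P\nabla f(x))-f(x^\star)}{f(x)-f(x^\star)}$, with gradient $\nabla r_x(P)=-\dfrac{\nabla f(x-P\nabla f(x))\nabla f(x)^\top}{f(x)-f(x^\star)}$. OSGM-R: for $k=1,2,\dots$: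 $x^{k+1}=x^k-P_k\nabla f(x^k)$ and $P_{k+1}=\Pi_{\mathcal{P}}[P_k-\eta\nabla r_{x^k}(P_k)]$, where $\Pi_{\mathcal{P}}$ is the orthogonal projection onto $\mathcal{P}$ (Frobenius inner product). The algorithm stops if an iterate is a minimizer of $f$; its output is the generated iterate with smallest objective value. *)

(* Defs.v *)
From mathcomp Require Import all_boot all_order all_algebra.
From mathcomp Require Import all_classical all_reals all_analysis.

Set Implicit Arguments.
Unset Strict Implicit.
Unset Printing Implicit Defensive.

Import Order.TTheory GRing.Theory Num.Theory.
Import numFieldNormedType.Exports.

Local Open Scope classical_set_scope.
Local Open Scope ring_scope.

(* MathComp-Analysis norms matrices by the largest absolute value of an entry,
   so the Euclidean and Frobenius norms are introduced here.  Vectors are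
   n x 1 matrices: [dot] and [fnorm] are then also the Euclidean inner product
   and norm.  Topological notions (closed, differentiable) do not depend on
   the choice of norm. *)
Definition dot (R : realType) (m n : nat) (A B : 'M[R]_(m, n)) : R :=
  \tr (A^T *m B).

Definition fnorm (R : realType) (m n : nat) (A : 'M[R]_(m, n)) : R :=
  Num.sqrt (dot A A).

(* Valued in \bar R: the real [sup] of an unbounded set is 0. *)
Definition diam (R : realType) (m n : nat) (Ps : set 'M[R]_(m, n)) : \bar R :=
  ereal_sup [set (fnorm (PQ.1 - PQ.2))%:E | PQ in Ps `*` Ps].

Definition is_min (R : realType) (S : set R) (m : R) : Prop :=
  S m /\ lbound S m.

(* The matrix of partial derivatives; used both for f : R^n -> R and for
   functions of a matrix variable. *)
Definition grad (R : realType) (m n : nat) (f : 'M[R]_(m, n) -> R)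
    (A : 'M[R]_(m, n)) : 'M[R]_(m, n) :=
  \matrix_(i, j) 'D_(delta_mx i j) f A.

Definition hess (R : realType) (n : nat) (f : 'cV[R]_n -> R) (x : 'cV[R]_n) :
    'M[R]_n :=
  \matrix_(i, j) 'D_(delta_mx j 0) (fun y => grad f y i 0) x.

Definition twice_differentiable (R : realType) (n : nat)
    (f : 'cV[R]_n -> R) : Prop :=
  (forall x, differentiable f x) /\ (forall x, differentiable (grad f) x).

Definition smooth (R : realType) (n : nat) (L : R) (f : 'cV[R]_n -> R) : Prop :=
  forall x y,
    `|f x - f y - dot (grad f y) (x - y)| <= L / 2 * fnorm (x - y) ^+ 2.

Definition strongly_convex (R : realType) (n : nat) (mu : R)
    (f : 'cV[R]_n -> R) : Prop :=
  forall x y,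
    mu / 2 * fnorm (x - y) ^+ 2 <= f x - f y - dot (grad f y) (x - y).

Definition is_minimizer (R : realType) (n : nat) (f : 'cV[R]_n -> R)
    (x : 'cV[R]_n) : Prop :=
  forall y, f x <= f y.

(* A strongly convex differentiable function has exactly one minimizer; the
   default 0 is only returned when there is none. *)
Definition argmin (R : realType) (n : nat) (f : 'cV[R]_n -> R) : 'cV[R]_n :=
  xget 0 [set x | is_minimizer f x].

Definition psd (R : realType) (n : nat) (A : 'M[R]_n) : Prop :=
  A^T = A /\ forall v : 'cV[R]_n, 0 <= dot v (A *m v).

Definition loewner (R : realType) (n : nat) (A B : 'M[R]_n) : Prop :=
  psd (B - A).

(* The positive semidefinite square root, which exists and is unique when P is
   positive semidefinite. *)
Definition psd_sqrt (R : realType) (n : nat) (P : 'M[R]_n) : 'M[R]_n :=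
  xget 0 [set S | psd S /\ S *m S = P].

(* The feasible values of kappa, for some P in the positive semidefinite part
   of Ps; the optimal condition number is the minimum of this set. *)
Definition condition_numbers (R : realType) (n : nat) (f : 'cV[R]_n -> R)
    (Ps : set 'M[R]_n) : set R :=
  [set kappa | 0 < kappa /\
     exists P, [/\ Ps P, psd P & forall x,
       let M := psd_sqrt P *m hess f x *m psd_sqrt P in
       loewner (kappa^-1)%:M M /\ loewner M 1%:M]].

Definition ratio_surrogate (R : realType) (n : nat) (f : 'cV[R]_n -> R)
    (x : 'cV[R]_n) (P : 'M[R]_n) : R :=
  (f (x - P *m grad f x) - f (argmin f)) / (f x - f (argmin f)).

(* Orthogonal projection: the nearest point of Ps in Frobenius norm, unique
   when Ps is nonempty, closed and convex. *)
Definition orth_proj (R : realType) (n : nat) (Ps : set 'M[R]_n) (A : 'M[R]_n) :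
    'M[R]_n :=
  xget 0 [set Q | Ps Q /\ forall Q', Ps Q' -> fnorm (A - Q) <= fnorm (A - Q')].

Definition osgm_step (R : realType) (n : nat) (f : 'cV[R]_n -> R)
    (Ps : set 'M[R]_n) (eta : R) (s : 'cV[R]_n * 'M[R]_n) :
    'cV[R]_n * 'M[R]_n :=
  (s.1 - s.2 *m grad f s.1,
   orth_proj Ps (s.2 - eta *: grad (ratio_surrogate f s.1) s.2)).

(* The iterate x^k, numbered from 1.  The sequence is total; it is the
   algorithm's only for those k at which [osgm_generates] holds. *)
Definition osgm_iterate (R : realType) (n : nat) (f : 'cV[R]_n -> R)
    (Ps : set 'M[R]_n) (eta : R) (x1 : 'cV[R]_n) (P1 : 'M[R]_n) (k : nat) :
    'cV[R]_n :=
  (iter k.-1 (osgm_step f Ps eta) (x1, P1)).1.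

(* x^k is generated in a run of K iterations, which stops as soon as an
   iterate is a minimizer. *)
Definition osgm_generates (R : realType) (n : nat) (f : 'cV[R]_n -> R)
    (Ps : set 'M[R]_n) (eta : R) (x1 : 'cV[R]_n) (P1 : 'M[R]_n) (K k : nat) :
    Prop :=
  (1 <= k <= K.+1)%N /\
  forall j, (1 <= j < k)%N ->
    ~ is_minimizer f (osgm_iterate f Ps eta x1 P1 j).

Definition osgm_stepsize (R : realType) (L D : R) (K : nat) : R :=
  Num.min (1 / (4 * L ^+ 2)) (D / (2 * L * (1 + L * D) * Num.sqrt K%:R)).

(* Main.v *)
Require Import Defs.
From mathcomp Require Import all_boot all_order all_algebra.
From mathcomp Require Import all_classical all_reals all_analysis.
From mathcomp Require Import ring lra.

Set Implicit Arguments.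
Unset Strict Implicit.
Unset Printing Implicit Defensive.

Import Order.TTheory GRing.Theory Num.Theory.
Import numFieldNormedType.Exports.

Local Open Scope classical_set_scope.
Local Open Scope ring_scope.

(* Optimal preconditioner: the constraint [kappa^-1 I <= P^{1/2} H P^{1/2} <= I]
   is equivalent to inequalities between quadratic forms in [P] and [P H P] that
   are closed in [(kappa^-1, P)], so a minimal [kappa] exists by compactness.
   For that [P], integrating the second derivative of [f] along the segments
   from [x] to [x - P grad f x] and to the minimizer gives
   [r_x P <= 1 - 1 / kappa].

   Complexity: [r_x] is convex with gradient at most [G = 2 L (1 + L D)] on the
   feasible set, so for large [K] projected gradient descent has regret at most
   [D G sqrt K] against the optimal [P].  As [r_{x^k} P_k] is the ratio of the
   consecutive optimality gaps and [r <= exp (r - 1)], the gap after [K] steps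
   is at most [exp (- K / kappa + D G sqrt K)] times the initial one, and the
   exponent is below [- K / (2 kappa)] for large [K]. *)

(** * Inner product and topology of matrices *)

Section Dot.
Context {R : realType} {m n : nat}.
Implicit Types (A B C : 'M[R]_(m, n)) (a : R).

Lemma dotE A B : dot A B = \sum_i \sum_j A i j * B i j.
Proof.
rewrite /dot /mxtrace exchange_big; apply: eq_bigr => j _ /=.
by rewrite mxE; apply: eq_bigr => i _; rewrite mxE.
Qed.

Lemma dotC A B : dot A B = dot B A.
Proof. by rewrite /dot -mxtrace_tr trmx_mul trmxK. Qed.

Lemma dotDl A B C : dot (A + B) C = dot A C + dot B C.
Proof. by rewrite /dot linearD mulmxDl mxtraceD. Qed.

Lemma dotDr A B C : dot C (A + B) = dot C A + dot C B.
Proof. by rewrite /dot mulmxDr mxtraceD. Qed.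

Lemma dotZl a A B : dot (a *: A) B = a * dot A B.
Proof. by rewrite /dot linearZ -scalemxAl mxtraceZ. Qed.

Lemma dotZr a A B : dot A (a *: B) = a * dot A B.
Proof. by rewrite dotC dotZl dotC. Qed.

Lemma dotNl A B : dot (- A) B = - dot A B.
Proof. by rewrite -scaleN1r dotZl mulN1r. Qed.

Lemma dotNr A B : dot A (- B) = - dot A B.
Proof. by rewrite dotC dotNl dotC. Qed.

Lemma dot0l A : dot 0 A = 0.
Proof. by rewrite -(scale0r A) dotZl mul0r. Qed.

Lemma dot0r A : dot A 0 = 0.
Proof. by rewrite dotC dot0l. Qed.

Definition dot_lin := (dotDl, dotDr, dotNl, dotNr, dotZl, dotZr).

Lemma dot_subZ A B a :
  dot (A - a *: B) (A - a *: B) = dot A A - 2 * a * dot A B + a ^+ 2 * dot B B.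
Proof. by rewrite !dot_lin (dotC B); ring. Qed.

Lemma dot_delta A i j : dot A (delta_mx i j) = A i j.
Proof.
rewrite dotE (bigD1 i) //= (bigD1 j) //= !mxE !eqxx mulr1.
rewrite [X in _ + X + _]big1 ?addr0; last first.
  by move=> k /negPf kj; rewrite mxE kj andbF mulr0.
rewrite big1 ?addr0 // => k /negPf ki.
by rewrite big1 // => l _; rewrite mxE ki mulr0.
Qed.

Lemma dot_ge0 A : 0 <= dot A A.
Proof.
by rewrite dotE; do 2!apply: sumr_ge0 => ? _; rewrite -expr2 sqr_ge0.
Qed.

Lemma sqr_entry_le A i j : A i j ^+ 2 <= dot A A.
Proof.
rewrite dotE (bigD1 i) //= (bigD1 j) //= -expr2 -addrA lerDl.
by apply: addr_ge0; repeat apply: sumr_ge0 => ? _; rewrite -expr2 sqr_ge0.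
Qed.

Lemma dot_eq0 A : (dot A A == 0) = (A == 0).
Proof.
apply/eqP/eqP => [A0|->]; last by rewrite dot0l.
apply/matrixP => i j; rewrite mxE; apply/eqP; rewrite -sqrf_eq0.
by rewrite eq_le sqr_ge0 andbT -[leRHS]A0 sqr_entry_le.
Qed.

Lemma dot_gt0 A : A != 0 -> 0 < dot A A.
Proof. by move=> A0; rewrite lt_neqAle eq_sym dot_eq0 A0 dot_ge0. Qed.

(** The squared length of [dot B B *: A - dot A B *: B] is [dot B B] times the defect of the
    inequality. *)
Lemma dot_cauchy A B : dot A B ^+ 2 <= dot A A * dot B B.
Proof.
have [->|B0] := eqVneq B 0; first by rewrite !dot0r expr0n mulr0.
have := dot_ge0 (dot B B *: A - dot A B *: B); rewrite !dot_lin (dotC B A).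
rewrite [leRHS](_ : _ = dot B B * (dot A A * dot B B - dot A B ^+ 2)).
  by rewrite pmulr_rge0 ?dot_gt0 // subr_ge0.
by ring.
Qed.

Lemma fnorm_sqr A : fnorm A ^+ 2 = dot A A.
Proof. by rewrite /fnorm sqr_sqrtr ?dot_ge0. Qed.

Lemma fnorm_ge0 A : 0 <= fnorm A.
Proof. exact: sqrtr_ge0. Qed.

Lemma ler_fnorm A B : (fnorm A <= fnorm B) = (dot A A <= dot B B).
Proof. by rewrite ler_sqrt ?dot_ge0. Qed.

Lemma dot_le_fnorm A B : dot A B <= fnorm A * fnorm B.
Proof.
apply: le_trans (ler_norm _) _; rewrite -ler_sqr ?nnegrE ?normr_ge0 //.
  by rewrite exprMn !fnorm_sqr real_normK ?num_real ?dot_cauchy.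
by rewrite mulr_ge0 ?fnorm_ge0.
Qed.

Lemma fnormD A B : fnorm (A + B) <= fnorm A + fnorm B.
Proof.
rewrite -ler_sqr ?nnegrE ?addr_ge0 ?fnorm_ge0 // sqrrD !fnorm_sqr !dot_lin.
by rewrite (dotC B A); have := dot_le_fnorm A B; lra.
Qed.

Lemma fnormZ a A : fnorm (a *: A) = `|a| * fnorm A.
Proof.
by rewrite /fnorm !dot_lin mulrA -expr2 sqrtrM ?sqr_ge0 // sqrtr_sqr.
Qed.

Lemma normr_dot_le A B : `|dot A B| <= fnorm A * fnorm B.
Proof.
rewrite ler_norml dot_le_fnorm andbT lerNl -dotNl.
by apply: le_trans (dot_le_fnorm _ _) _; rewrite /fnorm !dot_lin opprK.
Qed.

Lemma normr_mx_le A : `|A| <= fnorm A.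
Proof.
rewrite [leLHS]/Num.Def.normr/= mx_normrE; apply: bigmax_le => [|[i j] _ /=].
  exact: fnorm_ge0.
by rewrite -sqrtr_sqr ler_sqrt ?sqr_entry_le ?dot_ge0.
Qed.

(** With [normr_mx_le], this makes the Frobenius norm equivalent to the entrywise maximum norm, in
    which balls and little-o remainders are expressed. *)
Lemma fnorm_le_normr : exists2 c, 0 < c &
  forall A : 'M[R]_(m, n), fnorm A <= c * `|A|.
Proof.
(* The summand 1 keeps the constant positive when the matrix has no entries. *)
exists (1 + Num.sqrt (m * n)%:R); first by rewrite ltr_pwDl // sqrtr_ge0.
move=> A; rewrite mulrDl mul1r; apply: ler_wpDl => //.
rewrite -[`|A|]ger0_norm // -sqrtr_sqr -sqrtrM ?ler0n // ler_sqrt; last first.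
  by rewrite mulr_ge0 // sqr_ge0.
have le_entry i j : A i j * A i j <= `|A| ^+ 2.
  rewrite -expr2 -real_normK ?num_real // ler_sqr ?nnegrE //.
  rewrite [leRHS]/Num.Def.normr/= mx_normrE.
  by apply: (@le_bigmax _ _ _ _ (fun k => `|A k.1 k.2|) (i, j)).
rewrite dotE natrM -mulrA.
apply: le_trans (_ : \sum_(i < m) (n%:R * `|A| ^+ 2) <= _).
  apply: ler_sum => i _.
  apply: le_trans (_ : \sum_(j < n) (`|A| ^+ 2) <= _).
    by apply: ler_sum => j _.
  by rewrite sumr_const card_ord [leRHS]mulr_natl.
by rewrite sumr_const card_ord [leRHS]mulr_natl.
Qed.

End Dot.

Section DotMul.
Context {R : realType}.

Lemma dot_mull m n p (A : 'M[R]_(m, n)) (B : 'M[R]_(n, p)) (C : 'M[R]_(m, p)) :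
  dot (A *m B) C = dot B (A^T *m C).
Proof. by rewrite /dot trmx_mul mulmxA. Qed.

Lemma dot_mulr m n p (A : 'M[R]_(m, n)) (B : 'M[R]_(n, p)) (C : 'M[R]_(m, p)) :
  dot C (A *m B) = dot (A^T *m C) B.
Proof. by rewrite dotC dot_mull dotC. Qed.

Lemma dot_outer m n (A : 'M[R]_(m, n)) (u : 'cV[R]_m) (v : 'cV[R]_n) :
  dot A (u *m v^T) = dot (A *m v) u.
Proof.
by rewrite /dot trmx_mul mulmxA mxtrace_mulC mulmxA.
Qed.

(** Cauchy-Schwarz on each row of [A]: the Frobenius norm dominates the spectral norm. *)
Lemma dot_mulmx_le m n (A : 'M[R]_(m, n)) (v : 'cV[R]_n) :
  dot (A *m v) (A *m v) <= dot A A * dot v v.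
Proof.
rewrite [leLHS]dotE [dot A A]dotE mulr_suml; apply: ler_sum => i _.
rewrite big_ord1 -expr2.
have -> : (A *m v) i 0 = dot (row i A)^T v.
  by rewrite dotE mxE; apply: eq_bigr => j _; rewrite big_ord1 !mxE.
apply: le_trans (dot_cauchy _ _) _; rewrite ler_wpM2r ?dot_ge0 //.
rewrite dotE le_eqVlt; apply/orP; left; apply/eqP/eq_bigr => j _.
by rewrite big_ord1 !mxE.
Qed.

End DotMul.

(** * Continuity and compactness for matrices *)

Section MatrixTopology.
Context {R : realType}.

Lemma continuous_id (T : topologicalType) : continuous (fun x : T => x).
Proof. by move=> x A. Qed.

Lemma continuous_mx (T : topologicalType) m n (h : T -> 'M[R]_(m, n)) :
  (forall i j, continuous (fun x => h x i j)) -> continuous h.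
Proof.
move=> hc x A [P Px sPA]; rewrite /nbhs /=.
have : \forall y \near x, forall i j, P i j (h y i j).
  by do 2!apply: filter_forall => ?; apply: hc; apply: Px.
by apply: filterS => y Py; apply: sPA => i j; exact: Py.
Qed.

Lemma continuous_sumR (T : topologicalType) (I : Type) (r : seq I)
    (F : I -> T -> R) :
  (forall i, continuous (F i)) -> continuous (fun x => \sum_(i <- r) F i x).
Proof.
move=> Fc; elim: r => [|i r IH].
  by under eq_fun do rewrite big_nil; exact: cst_continuous.
under eq_fun do rewrite big_cons.
by move=> x; exact: (cvgD (Fc i x) (IH x)).
Qed.

Lemma continuous_entry (T : topologicalType) m n (h : T -> 'M[R]_(m, n)) i j :
  continuous h -> continuous (fun x => h x i j).
Proof.
by move=> hc x; exact: (continuous_comp (hc x) (@coord_continuous _ _ _ i j (h x))).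
Qed.

Arguments continuous_entry {T m n h} i j.

Lemma continuous_mulmx (T : topologicalType) m n p
    (h : T -> 'M[R]_(m, n)) (k : T -> 'M[R]_(n, p)) :
  continuous h -> continuous k -> continuous (fun x => h x *m k x).
Proof.
move=> hc kc; apply: continuous_mx => i j.
under eq_fun do rewrite mxE.
apply: continuous_sumR => l x.
exact: (cvgM (continuous_entry i l hc x) (continuous_entry l j kc x)).
Qed.

Lemma continuous_dot (T : topologicalType) m n (h k : T -> 'M[R]_(m, n)) :
  continuous h -> continuous k -> continuous (fun x => dot (h x) (k x)).
Proof.
move=> hc kc; under eq_fun do rewrite dotE.
apply: continuous_sumR => i; apply: continuous_sumR => j x.
exact: (cvgM (continuous_entry i j hc x) (continuous_entry i j kc x)).
Qed.

(** Heine-Borel, carried over from row vectors by the continuous surjection [vec_mx]. *)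
Lemma dot_bounded_closed_compact m n (A : set 'M[R]_(m, n)) (M : R) :
  (forall x, A x -> dot x x <= M) -> closed A -> compact A.
Proof.
move=> Ab Ac.
have vecc : continuous (vec_mx : 'rV[R]_(m * n) -> 'M[R]_(m, n)).
  apply: continuous_mx => i j; under eq_fun do rewrite mxE.
  exact: coord_continuous.
rewrite (_ : A = vec_mx @` (vec_mx @^-1` A)); last first.
  rewrite image_preimage // -subTset => x _.
  by exists (mxvec x) => //; rewrite mxvecK.
apply: continuous_compact; first exact: continuous_subspaceT.
apply: bounded_closed_compact; last exact: preimage_closed.
exists (Num.sqrt M); split; first exact: num_real.
move=> b Mb v /= /Ab vb; apply: le_trans (ltW Mb).
rewrite [leLHS]/Num.Def.normr/= mx_normrE; apply: bigmax_le => [|[i j] _ /=].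
  exact: sqrtr_ge0.
rewrite -sqrtr_sqr ler_sqrt ?(le_trans (dot_ge0 _) vb) //.
apply: le_trans vb; rewrite (ord1 i).
case/mxvec_indexP: j => k l; rewrite -[v]vec_mxK mxvecE vec_mxK.
exact: sqr_entry_le.
Qed.

Lemma closed_le_fun (T : topologicalType) (h k : T -> R) :
  continuous h -> continuous k -> closed [set x | h x <= k x].
Proof.
move=> hc kc; rewrite (_ : mkset _ = (fun x => k x - h x) @^-1` [set y | 0 <= y]).
  apply: preimage_closed; last exact: closed_ge.
  by move=> x _; exact: (cvgB (kc x) (hc x)).
by apply/seteqP; split => x /=; rewrite subr_ge0.
Qed.

Lemma compact_continuous_min (T : topologicalType) (h : T -> R) (A : set T) :
  A !=set0 -> compact A -> continuous h ->
  exists2 x, A x & forall y, A y -> h x <= h y.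
Proof.
move=> A0 Ac hc.
have [|c cA cmin] := compact_EVT_min A0 Ac (f := h).
  exact: continuous_subspaceT.
by exists c; [rewrite inE in cA|move=> y Ay; apply: cmin; rewrite inE].
Qed.

End MatrixTopology.

(** * Square roots of positive semidefinite matrices *)

Section PsdSqrt.
Context {R : realType}.

Lemma outer_mulmx m n (u : 'cV[R]_m) (v w : 'cV[R]_n) :
  u *m v^T *m w = dot v w *: u.
Proof.
by rewrite -mulmxA [v^T *m w]mx11_scalar mul_mx_scalar -trace_mx11.
Qed.

Lemma dot_mulmx_sym n (A : 'M[R]_n) (u v : 'cV[R]_n) :
  A^T = A -> dot u (A *m v) = dot (A *m u) v.
Proof. by move=> symA; rewrite dot_mulr symA. Qed.

(** With [w = A *m v] and [b = dot w (A *m w)], the form of [A] at [(b + 1) *: v - dot w w *: w] is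
    [- (b + 2) * dot w w ^+ 2]; its nonnegativity forces [w = 0]. *)
Lemma psd_kernel n (A : 'M[R]_n) (v : 'cV[R]_n) :
  psd A -> dot v (A *m v) = 0 -> A *m v = 0.
Proof.
move=> [symA A_ge0] Av0; set w := A *m v.
set b := dot w (A *m w); have b_ge0 : 0 <= b := A_ge0 w.
have := A_ge0 ((b + 1) *: v - dot w w *: w).
rewrite mulmxBr -!scalemxAr !dot_lin Av0 -/w (dot_mulmx_sym v w symA) -/w -/b.
set a := dot w w => H.
have : a ^+ 2 * (b + 2) <= 0 by lra.
rewrite pmulr_lle0; last by lra.
by rewrite le_eqVlt ltNge sqr_ge0 orbF sqrf_eq0 dot_eq0 => /eqP.
Qed.

(** Let [v] maximize the quadratic form on the unit sphere, with maximum [l]. Then [l%:M - A] is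
    positive semidefinite and its form vanishes at [v], so [v] lies in its kernel. *)
Lemma psd_eigenvector n (A : 'M[R]_n) : psd A -> A != 0 ->
  exists (l : R) (v : 'cV[R]_n), [/\ 0 < l, dot v v = 1 & A *m v = l *: v].
Proof.
move=> psdA A0; have [symA A_ge0] := psdA.
have [i [j Aij]] : exists i j, A i j != 0.
  apply: contrapT => A0'; move/eqP: A0; apply; apply/matrixP => i j.
  rewrite mxE; apply/eqP; apply: contrapT => /negP Aij; apply: A0'.
  by exists i, j.
have dotAc : continuous (fun v : 'cV[R]_n => dot v (A *m v)).
  apply: continuous_dot; first exact: continuous_id.
  by apply: continuous_mulmx; [exact: cst_continuous|exact: continuous_id].
have dotc : continuous (fun v : 'cV[R]_n => dot v v).
  by apply: continuous_dot; exact: continuous_id.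
have [||x|v /= v1 vmax] :=
    @compact_continuous_min _ _ (fun v => - dot v (A *m v))
      [set v : 'cV[R]_n | dot v v = 1].
- by exists (delta_mx i 0); rewrite /= dot_delta mxE !eqxx.
- apply: (@dot_bounded_closed_compact _ _ _ _ 1) => [x /= ->//|].
  rewrite (_ : mkset _ = (fun v => dot v v) @^-1` [set y | y = 1]) //.
  by apply: preimage_closed; [move=> x _; exact: dotc|exact: closed_eq].
- exact: (cvgN (dotAc x)).
set l := dot v (A *m v).
have lA (w : 'cV[R]_n) : dot w (A *m w) <= l * dot w w.
  have [->|w0] := eqVneq w 0; first by rewrite mulmx0 !dot0r mulr0.
  have w_gt0 := dot_gt0 w0; set c : R := (Num.sqrt (dot w w))^-1.
  have c2 : c ^+ 2 = (dot w w)^-1 by rewrite exprVn sqr_sqrtr // ltW.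
  have := vmax (c *: w).
  rewrite -scalemxAr !dot_lin !mulrA -expr2 c2 mulVf ?gt_eqF // => /(_ erefl).
  by rewrite lerN2 -/l ler_pdivrMl // mulrC.
have psdQ : psd (l%:M - A).
  split; first by rewrite linearB /= tr_scalar_mx symA.
  by move=> w; rewrite mulmxBl mul_scalar_mx !dot_lin subr_ge0.
have Av : A *m v = l *: v.
  apply/eqP; rewrite eq_sym -subr_eq0 -mul_scalar_mx -mulmxBl; apply/eqP.
  by apply: psd_kernel => //; rewrite mulmxBl mul_scalar_mx !dot_lin v1 mulr1 subrr.
(* If [l = 0], the form of [A] vanishes everywhere and [psd_kernel] kills every column of [A]. *)
exists l, v; split=> //; rewrite lt_neqAle A_ge0 andbT; apply: contraNneq A0 => l0.
apply/eqP/matrixP => i' j'; rewrite [RHS]mxE.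
suff -> : A i' j' = (A *m delta_mx j' (0 : 'I_1)) i' 0.
  rewrite psd_kernel ?mxE //; apply/le_anti; rewrite A_ge0 andbT.
  by apply: le_trans (lA _) _; rewrite -l0 mul0r.
rewrite mxE (bigD1 j') //= mxE !eqxx mulr1 big1 ?addr0 // => k /negPf kj.
by rewrite mxE kj mulr0.
Qed.

(* Deflation: subtracting [l v v^T] for a unit eigenvector [v] keeps the matrix
   positive semidefinite, puts [v] in its kernel and lowers its rank. *)
Lemma psd_sqrt_exists n (P : 'M[R]_n) :
  psd P -> exists S, psd S /\ S *m S = P.
Proof.
have [r] := ubnP (\rank P); elim: r => // r IH in P * => rP psdP.
have [->|P0] := eqVneq P 0.
  exists 0; rewrite mulmx0; split=> //; split; first by rewrite trmx0.
  by move=> v; rewrite mul0mx dot0r.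
have [symP P_ge0] := psdP.
have [l [v [l_gt0 v1 Pv]]] := psd_eigenvector psdP P0.
have vP : v^T *m P = l *: v^T by rewrite -[in LHS]symP -trmx_mul Pv linearZ.
pose V := v *m v^T.
have VV : V *m V = V by rewrite /V mulmxA outer_mulmx v1 scale1r.
have symV : V^T = V by rewrite trmx_mul trmxK.
have dotV w : dot w (V *m w) = dot v w ^+ 2.
  by rewrite outer_mulmx dot_lin (dotC w) expr2.
pose P' := P - l *: V.
have P'v : P' *m v = 0.
  by rewrite mulmxBl Pv -scalemxAl outer_mulmx v1 scale1r subrr.
have psdP' : psd P'.
  split=> [|w]; first by rewrite linearB linearZ /= symP symV.
  (* The form of [P'] at [w] is the form of [P] at the component of [w] orthogonal to [v]. *)
  have := P_ge0 (w - dot v w *: v).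
  rewrite mulmxBl mulmxBr -scalemxAr -scalemxAl Pv !dot_lin dotV v1.
  by rewrite (dot_mulmx_sym v w symP) Pv dotZl (dotC w v); lra.
have rP' : (\rank P' < r)%N.
  rewrite -ltnS; apply: leq_trans rP; rewrite ltnS; apply: rank_ltmx.
  (* The row space shrinks strictly: it contains [v^T] for [P], but not for [P'], since
     [P' *m v = 0] while [v] has length 1. *)
  rewrite ltmxE; apply/andP; split.
    have -> : P' = (1%:M - V) *m P.
      by rewrite mulmxBl mul1mx -mulmxA vP -scalemxAr.
    exact: submxMl.
  apply/negP => PP'.
  have /submxP[X vX] : (v^T <= P')%MS.
    apply: submx_trans PP'; have -> : v^T = (l^-1 *: v^T) *m P.
      by rewrite -scalemxAl vP scalerA mulVf ?gt_eqF // scale1r.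
    exact: submxMl.
  have := oner_neq0 R; rewrite -v1 {1}/dot vX -mulmxA P'v mulmx0 mxtrace0.
  by rewrite eqxx.
have [S [[symS S_ge0] SS]] := IH P' rP' psdP'.
(* This removes the cross terms when [S + Num.sqrt l *: V] is squared. *)
have Sv : S *m v = 0.
  by apply/eqP; rewrite -dot_eq0 -dot_mulmx_sym // mulmxA SS P'v dot0r.
have vS : v^T *m S = 0 by rewrite -[in LHS]symS -trmx_mul Sv trmx0.
exists (S + Num.sqrt l *: V); split; first split.
- by rewrite linearD linearZ /= symS symV.
- move=> w; rewrite mulmxDl -scalemxAl !dot_lin dotV addr_ge0 //.
  by rewrite mulr_ge0 ?sqrtr_ge0 ?sqr_ge0.
rewrite mulmxDl !mulmxDr -!scalemxAl -!scalemxAr SS VV scalerA -expr2.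
rewrite sqr_sqrtr ?(ltW l_gt0) // mulmxA Sv mul0mx -[_ *m _ *m S]mulmxA vS mulmx0.
by rewrite !scaler0 addr0 add0r subrK.
Qed.

Lemma psd_sqrtP n (P : 'M[R]_n) :
  psd P -> psd (psd_sqrt P) /\ psd_sqrt P *m psd_sqrt P = P.
Proof.
move=> /psd_sqrt_exists sqP.
exact: (@xgetPex _ 0 [set S | psd S /\ S *m S = P] sqP).
Qed.

End PsdSqrt.

(** * Derivatives *)

Section Calculus.
Context {R : realType}.

Lemma cvg_is_derive (V W : normedModType R) (F : V -> W) (a v : V) (l : W) :
  h^-1 *: (F (h *: v + a) - F a) @[h --> 0^'] --> l -> is_derive a v F l.
Proof.
move=> Fl; apply: DeriveDef; last exact: cvg_lim.
by apply/cvg_ex; exists l.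
Qed.

Lemma is_derive_cvg (V W : normedModType R) (F : V -> W) (a v : V) (l : W) :
  is_derive a v F l -> h^-1 *: (F (h *: v + a) - F a) @[h --> 0^'] --> l.
Proof. by move=> [Fd <-]; exact: Fd. Qed.

Lemma is_derive_line (V W : normedModType R) (F : V -> W) (x d : V) (t : R) :
  differentiable F (x + t *: d) ->
  is_derive t (1 : R) (fun s => F (x + s *: d)) ('D_d F (x + t *: d)).
Proof.
move=> /diff_derivable - /(_ d) /derivableP /is_derive_cvg Fd.
apply: cvg_is_derive; apply: cvg_trans Fd; apply: near_eq_cvg.
by near=> h; rewrite /= [h *: 1]mulr1 scalerDl addrCA.
Unshelve. all: by end_near. Qed.

Lemma is_derive_dot (V : normedModType R) m n (G : V -> 'M[R]_(m, n)) (a v : V)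
    (l w : 'M[R]_(m, n)) :
  is_derive a v G l -> is_derive a v (fun s => dot (G s) w) (dot l w).
Proof.
move=> /is_derive_cvg Gl; apply: cvg_is_derive.
have dotc : continuous (fun M : 'M[R]_(m, n) => dot M w).
  by apply: continuous_dot; [exact: continuous_id|exact: cst_continuous].
have := cvg_comp _ _ Gl (dotc l); apply: cvg_trans; apply: near_eq_cvg.
by near=> h; rewrite /= dotZl dotDl dotNl.
Unshelve. all: by end_near. Qed.

Lemma derive_grad m n (f : 'M[R]_(m, n) -> R) a v :
  differentiable f a -> 'D_v f a = dot (grad f a) v.
Proof.
move=> df; rewrite deriveE // {1}(matrix_sum_delta v) linear_sum dotE.
apply: eq_bigr => i _; rewrite linear_sum; apply: eq_bigr => j _.
by rewrite linearZ /= mxE deriveE // mulrC.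
Qed.

Lemma derive_hess n (f : 'cV[R]_n -> R) x v :
  differentiable (grad f) x -> 'D_v (grad f) x = hess f x *m v.
Proof.
move=> dg; rewrite derive_mx; last exact: diff_derivable.
apply/matrixP => i j; rewrite !mxE (ord1 j) derive_grad; last first.
  exact: (differentiable_comp dg (differentiable_coord _ _ _)).
by rewrite dotE; apply: eq_bigr => k _; rewrite big_ord1 !mxE.
Qed.

(** The mean value theorem, applied to [dphi] and then to [phi] minus the comparison quadratic,
    takes the place of integrating [ddphi] twice. *)
Lemma taylor2_ub (phi dphi ddphi : R -> R) c :
  (forall t, is_derive t (1 : R) phi (dphi t)) ->
  (forall t, is_derive t (1 : R) dphi (ddphi t)) ->
  (forall t, ddphi t <= c) -> phi 1 <= phi 0 + dphi 0 + c / 2.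
Proof.
move=> d1 d2 ub.
have cont (g dg : R -> R) : (forall t, is_derive t (1 : R) g (dg t)) ->
    forall a b, {within `[a, b], continuous g}.
  move=> gd a b; apply: derivable_within_continuous => t _.
  by case: (gd t).
have dphi_ub t : 0 <= t -> dphi t <= dphi 0 + c * t.
  move=> t0; have [|x _] := MVT_segment t0 (fun x _ => d2 x).
    exact: cont d2 _ _.
  rewrite subr0 => E; rewrite -lerBlDl E; exact: ler_wpM2r.
pose psi t := phi t - (dphi 0 * t + c / 2 * t ^+ 2).
have dpsi t : is_derive t (1 : R) psi (dphi t - (dphi 0 + c * t)).
  have := d1 t => d1t; rewrite /psi.
  apply: is_derive_eq.
  by rewrite /GRing.scale /=; field.
have [|x] := MVT_segment (@ler01 R) (fun x _ => dpsi x).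
  exact: cont dpsi _ _.
rewrite in_itv /= => /andP[x0 _]; rewrite /psi.
have := dphi_ub x x0; lra.
Qed.

Lemma taylor2_lb (phi dphi ddphi : R -> R) c :
  (forall t, is_derive t (1 : R) phi (dphi t)) ->
  (forall t, is_derive t (1 : R) dphi (ddphi t)) ->
  (forall t, c <= ddphi t) -> phi 0 + dphi 0 + c / 2 <= phi 1.
Proof.
move=> d1 d2 lb.
have Nd (g dg : R -> R) : (forall t, is_derive t (1 : R) g (dg t)) ->
    forall t, is_derive t (1 : R) (fun t => - g t) (- dg t).
  by move=> gd t; exact: is_deriveN.
have Nlb t : - ddphi t <= - c by rewrite lerN2.
have := taylor2_ub (Nd _ _ d1) (Nd _ _ d2) Nlb; lra.
Qed.

Lemma is_derive_bounds (g : R -> R) (a l lo hi : R) : is_derive a (1 : R) g l ->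
  (forall h, h != 0 -> lo <= h^-1 * (g (h + a) - g a) <= hi) -> lo <= l <= hi.
Proof.
move=> /is_derive_cvg gl gb.
have gb' : \forall h \near (0 : R)^',
    lo <= h^-1 *: (g (h *: (1 : R) + a) - g a) <= hi.
  near=> h; rewrite [h *: 1]mulr1; apply: gb.
  by near: h; exact: nbhs_dnbhs_neq.
apply/andP; split.
  apply: (@closed_cvg _ _ _ _ _ [set y : R | lo <= y] (@closed_ge _ lo) _ _ gl).
  by apply: filterS gb' => h /andP[].
apply: (@closed_cvg _ _ _ _ _ [set y : R | y <= hi] (@closed_le _ hi) _ _ gl).
by apply: filterS gb' => h /andP[].
Unshelve. all: by end_near. Qed.

End Calculus.

(** * Symmetry of the Hessian *)

Section SymmetricHessian.
Context {R : realType} {n : nat} (f : 'cV[R]_n -> R).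
Context (f_diff : twice_differentiable f).

Lemma objective_continuous : continuous f.
Proof. by move=> x; apply: differentiable_continuous; exact: (f_diff.1 x). Qed.

Lemma is_derive_objective_line x d t :
  is_derive t (1 : R) (fun s => f (x + s *: d)) (dot (grad f (x + t *: d)) d).
Proof.
rewrite -derive_grad; last exact: (f_diff.1 _).
by apply: is_derive_line; exact: (f_diff.1 _).
Qed.

Lemma is_derive_grad_line x d w t :
  is_derive t (1 : R) (fun s => dot (grad f (x + s *: d)) w)
    (dot (hess f (x + t *: d) *m d) w).
Proof.
apply: is_derive_dot; rewrite -derive_hess; last exact: (f_diff.2 _).
by apply: is_derive_line; exact: (f_diff.2 _).
Qed.

(** Differentiability of the gradient in epsilon-delta form; the tolerance [e / c] absorbs the
    passage from the maximum norm to [fnorm]. *)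
Lemma grad_expansion x (e : R) : 0 < e -> exists2 r, 0 < r &
  forall h, fnorm h < r ->
    fnorm (grad f (x + h) - grad f x - hess f x *m h) <= e * fnorm h.
Proof.
move=> e0; have [c c0 cN] := @fnorm_le_normr R n 1.
have dgx := f_diff.2 x; have := diff_locallyx dgx; set k := 'o _ => E.
have /(littleoP [littleo of k]) /nbhs_ballP[r r0 Hr] : 0 < e / c.
  by rewrite divr_gt0.
exists r => // h hr.
have -> : grad f (x + h) - grad f x - hess f x *m h = k h.
  rewrite (addrC x) E -derive_hess // deriveE //.
  by rewrite -addrA -opprD addrC addKr.
apply: le_trans (cN _) _; rewrite -ler_pdivlMl //.
apply: le_trans (Hr _ _) _.
  rewrite -ball_normE /= sub0r normrN.
  by apply: le_lt_trans hr; exact: normr_mx_le.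
rewrite mulrA (mulrC c^-1); apply: ler_wpM2l; last exact: normr_mx_le.
by rewrite divr_ge0 // ltW.
Qed.

(* The Hessian need not be continuous, so its symmetry is read off the second
   difference of [f], expanded with the Frechet derivative of the gradient. *)
Lemma second_difference x u w (e : R) : 0 < e -> exists2 r, 0 < r &
  forall t, 0 < t < r ->
    `|f (x + t *: u + t *: w) - f (x + t *: u) - f (x + t *: w) + f x
      - t ^+ 2 * dot (hess f x *m u) w| <= e * t ^+ 2.
Proof.
move=> e0; set U := fnorm u; set W := fnorm w.
have U0 : 0 <= U := fnorm_ge0 u; have W0 : 0 <= W := fnorm_ge0 w.
(* The two expansion errors below add up to at most [e * t ^+ 2 * ((M - 1) / M)]; the summand 1
   makes [M] positive. *)
set M := 1 + (U + 2 * W) * W.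
have M0 : 0 < M by rewrite ltr_wpDr // mulr_ge0 // addr_ge0 // mulr_ge0.
have [d d0 Hd] := @grad_expansion x (e / M) (divr_gt0 e0 M0).
exists (d / (U + W + 1)); first by rewrite divr_gt0 //; lra.
move=> t /andP[t0 tr]; rewrite ltr_pdivlMr in tr; last by lra.
(* The second difference is [g t - g 0], so the mean value theorem turns it into a difference of two
   gradients paired with [w]. *)
pose g s := f (x + t *: u + s *: w) - f (x + s *: w).
have dg s : is_derive s (1 : R) g
    (dot (grad f (x + t *: u + s *: w)) w - dot (grad f (x + s *: w)) w).
  apply: is_deriveB; exact: is_derive_objective_line.
have [|xi] := MVT_segment (ltW t0) (fun s _ => dg s).
  by apply: derivable_within_continuous => s _; case: (dg s).
rewrite in_itv /= subr0 /g => /andP[xi0 xit].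
rewrite !scale0r !addr0 => E.
have Eu : fnorm (t *: u + xi *: w) <= t * (U + W).
  apply: le_trans (fnormD _ _) _; rewrite !fnormZ !ger0_norm ?(ltW t0) //.
  by rewrite mulrDr lerD2l ler_wpM2r.
have Ew : fnorm (xi *: w) <= t * W.
  by rewrite fnormZ ger0_norm // ler_wpM2r.
have bU : t * (U + W) < d by nra.
have bW : t * W < d by nra.
have H1 := Hd _ (le_lt_trans Eu bU); have H2 := Hd _ (le_lt_trans Ew bW).
set e1 := _ - _ - _ in H1; set e2 := _ - _ - _ in H2.
(* Both gradients are expanded around [x]; the contributions of [xi *: w] cancel and only the
   Hessian at [t *: u] remains. *)
have Edot : dot (grad f (x + t *: u + xi *: w)) w - dot (grad f (x + xi *: w)) w
    = t * dot (hess f x *m u) w + (dot e1 w - dot e2 w).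
  rewrite /e1 /e2 (addrA x) !mulmxDr -!scalemxAr !dot_lin; ring.
rewrite [X in `|X|](_ : _ = t * (dot e1 w - dot e2 w)); last first.
  transitivity (t * (dot (grad f (x + t *: u + xi *: w)) w -
      dot (grad f (x + xi *: w)) w) - t ^+ 2 * dot (hess f x *m u) w).
    by rewrite (mulrC t) -E; ring.
  by rewrite Edot; ring.
rewrite normrM (gtr0_norm t0).
have eM0 : 0 <= e / M by rewrite divr_ge0 // ltW.
have D1 : `|dot e1 w| <= e / M * (t * (U + W)) * W.
  apply: le_trans (normr_dot_le _ _) _; rewrite ler_wpM2r //.
  by apply: le_trans H1 _; rewrite ler_wpM2l.
have D2 : `|dot e2 w| <= e / M * (t * W) * W.
  apply: le_trans (normr_dot_le _ _) _; rewrite ler_wpM2r //.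
  by apply: le_trans H2 _; rewrite ler_wpM2l.
apply: le_trans (_ : t * (e / M * (t * W) * W + e / M * (t * (U + W)) * W) <= _).
  rewrite ler_pM2l //; apply: le_trans (ler_normB _ _) _.
  by rewrite addrC lerD.
have -> : t * (e / M * (t * W) * W + e / M * (t * (U + W)) * W) =
   e * t ^+ 2 * ((M - 1) / M) by rewrite /M; ring.
rewrite -[leRHS]mulr1; apply: ler_wpM2l.
  by rewrite mulr_ge0 ?sqr_ge0 ?(ltW e0).
by rewrite ler_pdivrMr // mul1r gerBl.
Qed.

(** The second difference is symmetric in [u] and [w], so it approximates both [t ^+ 2 * a] and
    [t ^+ 2 * b]. With tolerance a quarter of [|a - b|] for each, [|a - b|] would be at most half of
    itself. *)
Lemma hess_dotC x (u w : 'cV[R]_n) : dot (hess f x *m u) w = dot (hess f x *m w) u.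
Proof.
set a := dot _ w; set b := dot _ u.
have [//|/eqP ab] := eqVneq a b.
have ab0 : 0 < `|a - b| / 4 by rewrite divr_gt0 // normr_gt0 subr_eq0; exact/eqP.
have [r1 r10 H1] := second_difference x u w ab0.
have [r2 r20 H2] := second_difference x w u ab0.
pose t := Num.min r1 r2 / 2.
have t0 : 0 < t by rewrite divr_gt0 // lt_min r10.
have tr1 : 0 < t < r1.
  by rewrite t0 ltr_pdivrMr // gt_min; apply/orP; left; lra.
have tr2 : 0 < t < r2.
  by rewrite t0 ltr_pdivrMr // gt_min; apply/orP; right; lra.
have := H2 t tr2; have := H1 t tr1; rewrite -/a -/b.
rewrite (addrAC x (t *: w)); set D1 := _ - _ + f x => A1.
rewrite (_ : _ - _ - _ + f x = D1) => [A2|]; last by rewrite /D1; ring.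
have : `|t ^+ 2 * (a - b)| <= 2 * (`|a - b| / 4 * t ^+ 2).
  rewrite (_ : t ^+ 2 * (a - b) = D1 - t ^+ 2 * b - (D1 - t ^+ 2 * a));
    last by ring.
  by apply: le_trans (ler_normB _ _) _; rewrite mulr2n mulrDl mul1r lerD.
have t20 : 0 < t ^+ 2 by rewrite exprn_gt0.
by rewrite normrM (gtr0_norm t20); nra.
Qed.

Lemma hess_sym x : (hess f x)^T = hess f x.
Proof.
apply/matrixP => i j; rewrite mxE.
have E k l : hess f x k l = dot (hess f x *m delta_mx l 0) (delta_mx k (0 : 'I_1)).
  rewrite dot_delta [RHS]mxE (bigD1 l) //= [delta_mx _ _ _ _]mxE !eqxx mulr1.
  rewrite big1 ?addr0 // => p /negPf pl.
  by rewrite [delta_mx _ _ _ _]mxE pl mulr0.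
by rewrite !E hess_dotC.
Qed.

End SymmetricHessian.

(** * The objective function and the optimal preconditioner *)

Lemma closed_forall (T : topologicalType) (I : Type) (A : I -> set T) :
  (forall i, closed (A i)) -> closed [set x | forall i, A i x].
Proof.
move=> Ac; rewrite (_ : mkset _ = \bigcap_i A i).
  by apply: closed_bigI => i _; exact: Ac.
by apply/seteqP; split => x /= Ax i; [move=> _|]; exact: Ax.
Qed.

Lemma fnorm_sub_le_diam (R : realType) m n (Ps : set 'M[R]_(m, n)) (D : R) :
  (diam Ps <= D%:E)%E -> forall P Q, Ps P -> Ps Q -> fnorm (P - Q) <= D.
Proof.
move=> dD P Q PP PQ; rewrite -lee_fin; apply: le_trans dD.
by apply: ereal_sup_ubound; exists (P, Q).
Qed.

Lemma fnorm_le_diam (R : realType) m n (Ps : set 'M[R]_(m, n)) (D : R) P :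
  Ps 0 -> (diam Ps <= D%:E)%E -> Ps P -> fnorm P <= D.
Proof. by move=> P0 PD PP; have := fnorm_sub_le_diam PD PP P0; rewrite subr0. Qed.

Lemma closed_diam_compact (R : realType) m n (Ps : set 'M[R]_(m, n)) (D : R) :
  closed Ps -> Ps 0 -> (diam Ps <= D%:E)%E -> compact Ps.
Proof.
move=> Pcl P0 PD; apply: (dot_bounded_closed_compact (M := D ^+ 2)) Pcl => P PP.
have P_le := fnorm_le_diam P0 PD PP.
by rewrite -fnorm_sqr ler_sqr ?nnegrE ?fnorm_ge0 // (le_trans _ P_le) ?fnorm_ge0.
Qed.

(** By symmetry, the transpose of a row in the left kernel of [P] is annihilated by [P], and
    coercivity makes it zero. *)
Lemma posdef_unitmx (R : realType) n (P : 'M[R]_n) (c : R) : P^T = P -> 0 < c ->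
  (forall v : 'cV[R]_n, c * dot v v <= dot v (P *m v)) -> P \in unitmx.
Proof.
move=> symP c0 posP; rewrite -row_free_unit -kermx_eq0; apply/eqP/row_matrixP => i.
rewrite row0; set r := row i _.
have Pr : P *m r^T = 0.
  by rewrite -[in LHS]symP -trmx_mul /r -row_mul mulmx_ker row0 trmx0.
have := posP r^T; rewrite Pr dot0r pmulr_rle0 // => r0.
apply/trmx_inj/eqP; rewrite trmx0 -dot_eq0 eq_le r0; exact: dot_ge0.
Qed.

Section Objective.
Context {R : realType} {n : nat} (f : 'cV[R]_n -> R) (L mu : R).
Context (n_gt0 : (0 < n)%N) (L_gt0 : 0 < L) (mu_gt0 : 0 < mu).
Context (f_diff : twice_differentiable f) (f_smooth : smooth L f).
Context (f_convex : strongly_convex mu f).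

Local Notation g := (grad f).
Local Notation fstar := (f (argmin f)).

Lemma objective_bounds x d :
  f x + dot (g x) d + mu / 2 * dot d d <= f (x + d)
    <= f x + dot (g x) d + L / 2 * dot d d.
Proof.
have := f_convex (x + d) x; have := f_smooth (x + d) x.
rewrite fnorm_sqr (addrC x d) addrK ler_norml => /andP[_ h1] h2.
by apply/andP; split; lra.
Qed.

(** The bounds for the step [d] from [x] and for the step back from [x + d] are added. *)
Lemma grad_increment x d :
  mu * dot d d <= dot (g (x + d) - g x) d <= L * dot d d.
Proof.
have /andP[h1 h2] := objective_bounds x d.
have := objective_bounds (x + d) (- d); rewrite addrK !dot_lin => /andP[h3 h4].
by apply/andP; split; lra.
Qed.

Lemma hess_bounds x (v : 'cV[R]_n) :
  mu * dot v v <= dot (hess f x *m v) v <= L * dot v v.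
Proof.
have := is_derive_grad_line f_diff x v v 0; rewrite scale0r addr0 => dg.
apply: (is_derive_bounds dg) => h h0.
rewrite addr0 scale0r addr0 -dotNl -dotDl.
have := grad_increment x (h *: v); rewrite !dotZl !dotZr.
set q := dot (_ - _) v => /andP[q1 q2].
have h2 : 0 < h ^+ 2 by rewrite lt_neqAle sqr_ge0 eq_sym sqrf_eq0 h0.
(* Dividing by [h ^+ 2] treats both signs of [h] at once. *)
rewrite (_ : h^-1 * q = h * q / h ^+ 2); last by field.
by rewrite ler_pdivlMr // ler_pdivrMr // expr2; apply/andP; split; lra.
Qed.

Lemma minimizer_exists : exists x, is_minimizer f x.
Proof.
have fc := objective_continuous f_diff.
have [||//|x xS xmin] := @compact_continuous_min _ _ f [set x | f x <= f 0].
- by exists 0 => /=.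
(* On the sublevel set of 0, [mu / 2 * dot x x <= - dot (g 0) x]; the radius then follows from the
   nonnegative squared length of [mu / 2 *: x + g 0]. *)
- apply: (@dot_bounded_closed_compact _ _ _ _ (4 * dot (g 0) (g 0) / mu ^+ 2)).
    move=> x /= xS; have /andP[lb _] := objective_bounds 0 x.
    rewrite add0r in lb; rewrite ler_pdivlMr ?exprn_gt0 //.
    have := dot_ge0 (mu / 2 *: x + g 0); rewrite !dot_lin (dotC x (g 0)) => h.
    have : mu * (dot (g 0) x + mu / 2 * dot x x) <= 0 by rewrite pmulr_rle0 //; lra.
    by lra.
  by apply: closed_le_fun => //; exact: cst_continuous.
exists x => y; have [yS|] := leP (f y) (f 0); first exact: xmin.
by move=> /ltW; exact: le_trans.
Qed.

Lemma argmin_le x : fstar <= f x.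
Proof. exact: (xgetPex 0 minimizer_exists). Qed.

Lemma minimizerP x : f x <= fstar -> is_minimizer f x.
Proof. by move=> xs y; apply: le_trans xs _; exact: argmin_le. Qed.

Lemma gap_gt0 x : ~ is_minimizer f x -> 0 < f x - fstar.
Proof.
by move=> xN; rewrite subr_gt0 ltNge; apply/negP => /minimizerP.
Qed.

(** The gradient step of length [L^-1] lowers [f] by at least [dot (g x) (g x) / (2 * L)], yet not
    below the minimum. *)
Lemma grad_sqr_le x : dot (g x) (g x) <= 2 * L * (f x - fstar).
Proof.
have /andP[_] := objective_bounds x (- (L^-1 *: g x)).
have := argmin_le (x - L^-1 *: g x).
rewrite !dot_lin; set q := dot _ _ => h1 h2.
have E : L / 2 * - - (L^-1 * (L^-1 * q)) = L^-1 * q / 2 by field; rewrite gt_eqF.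
have : L * (L^-1 * q) <= L * (2 * (f x - fstar)).
  by rewrite ler_pM2l //; lra.
by rewrite mulVKf ?gt_eqF // mulrCA mulrA.
Qed.

End Objective.

(* The matrices [P] that attain condition number [t^-1]: conjugating by
   [P^{1/2}] turns [t I <= P^{1/2} H P^{1/2} <= I] into conditions that are
   closed in [(t, P)] and do not mention the square root.  The first inequality
   is a consequence of the others when [P] is positive definite; it keeps limits
   of such [P] invertible. *)
Definition preconditions (R : realType) (n : nat) (f : 'cV[R]_n -> R) (L t : R)
    (P : 'M[R]_n) : Prop :=
  P^T = P /\ forall (v x : 'cV[R]_n),
    [/\ t / L * dot v v <= dot v (P *m v),
        t * dot v (P *m v) <= dot (hess f x *m (P *m v)) (P *m v)
      & dot (hess f x *m (P *m v)) (P *m v) <= dot v (P *m v)].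

(** * Attainment of the optimal condition number and the resulting contraction *)

Section OptimalPreconditioner.
Context {R : realType} {n : nat} (f : 'cV[R]_n -> R) (L mu : R).
Context (n_gt0 : (0 < n)%N) (L_gt0 : 0 < L) (mu_gt0 : 0 < mu).
Context (f_diff : twice_differentiable f) (f_smooth : smooth L f).
Context (f_convex : strongly_convex mu f).

Local Notation g := (grad f).
Local Notation fstar := (f (argmin f)).

Lemma condition_numbersP (Ps : set 'M[R]_n) kappa : 0 < kappa ->
  condition_numbers f Ps kappa <->
  exists2 P, Ps P & preconditions f L kappa^-1 P.
Proof.
move=> kappa0; have t0 : 0 < kappa^-1 by rewrite invr_gt0.
split=> [[_ [P [PP psdP HP]]]|[P PP [symP HP]]].
  exists P => //; split=> [|v x]; first exact: psdP.1.
  have [[symS S_ge0] SS] := psd_sqrtP psdP.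
  set S := psd_sqrt P in HP symS S_ge0 SS.
  have SSv (w : 'cV[R]_n) : S *m (S *m w) = P *m w by rewrite mulmxA SS.
  have Pv (w : 'cV[R]_n) : dot w (P *m w) = dot (S *m w) (S *m w).
    by rewrite -SS -mulmxA dot_mulmx_sym.
  have [/= [_ lo] [_ hi]] := HP x.
  have {}lo (w : 'cV[R]_n) :
      kappa^-1 * dot w w <= dot (hess f x *m (S *m w)) (S *m w).
    have := lo w; rewrite mulmxBl mul_scalar_mx !dot_lin subr_ge0 -!mulmxA.
    by rewrite dot_mulmx_sym // dotC.
  have {}hi (w : 'cV[R]_n) : dot (hess f x *m (S *m w)) (S *m w) <= dot w w.
    have := hi w; rewrite mulmxBl mul1mx !dot_lin subr_ge0 -!mulmxA.
    by rewrite dot_mulmx_sym // dotC.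
  split.
  (* Positive definiteness of [P]: [lo v] is combined with the upper bound [L] on the Hessian at
     [S *m v]. *)
  - rewrite Pv mulrAC ler_pdivrMr // mulrC (mulrC _ L).
    rewrite mulrC; apply: le_trans (lo v) _.
    by have /andP[] := hess_bounds f_diff f_smooth f_convex x (S *m v).
  - by have := lo (S *m v); rewrite SSv Pv.
  - by have := hi (S *m v); rewrite SSv Pv.
have tL0 : 0 < kappa^-1 / L by rewrite divr_gt0.
have P_ge (v : 'cV[R]_n) : kappa^-1 / L * dot v v <= dot v (P *m v).
  by have [] := HP v 0.
have psdP : psd P.
  split=> // v; apply: le_trans (P_ge v).
  by rewrite mulr_ge0 ?dot_ge0 // ltW.
split=> //; exists P; split=> // x M.
have [[symS S_ge0] SS] := psd_sqrtP psdP.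
set S := psd_sqrt P in M symS S_ge0 SS *.
have Su : S \in unitmx.
  by have := posdef_unitmx symP tL0 P_ge; rewrite -SS unitmx_mul => /andP[].
have symM : M^T = M by rewrite /M !trmx_mul symS hess_sym // mulmxA.
(* Since [S] is invertible, every [v] is [S *m u], and the forms in [v] become forms in [P *m u]. *)
have ME (v : 'cV[R]_n) : exists2 u : 'cV[R]_n, dot v v = dot u (P *m u) &
    dot v (M *m v) = dot (hess f x *m (P *m u)) (P *m u).
  exists (invmx S *m v).
    by rewrite -SS -mulmxA mulKVmx // dot_mulmx_sym // mulKVmx.
  rewrite -SS -mulmxA mulKVmx // /M -!mulmxA dot_mulmx_sym //.
  by rewrite dotC.
split; split.
- by rewrite linearB /= tr_scalar_mx symM.
- move=> v; rewrite mulmxBl mul_scalar_mx !dot_lin subr_ge0.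
  by have [u -> ->] := ME v; have [] := HP u x.
- by rewrite linearB /= tr_scalar_mx symM.
- move=> v; rewrite mulmxBl mul1mx !dot_lin subr_ge0.
  by have [u -> ->] := ME v; have [] := HP u x.
Qed.

Lemma exists_dot_gt0 : exists v : 'cV[R]_n, 0 < dot v v.
Proof.
exists (delta_mx (Ordinal n_gt0) 0).
by rewrite dot_delta mxE !eqxx ltr01.
Qed.

(** Minimizing [kappa] is maximizing [t = kappa^-1] over a compact set of pairs [(t, P)]. *)
Lemma optimal_preconditioner (Ps : set 'M[R]_n) (D : R) :
  closed Ps -> Ps 0 -> Ps (L^-1)%:M -> (diam Ps <= D%:E)%E ->
  exists kappa P, [/\ 0 < kappa, Ps P, preconditions f L kappa^-1 P &
    is_min (condition_numbers f Ps) kappa].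
Proof.
move=> Pcl P0 PL PD; have [e e0] := exists_dot_gt0.
pose Z := [set z : R * 'M[R]_n | [/\ `[0, 1]%classic z.1, Ps z.2 &
  preconditions f L z.1 z.2]].
have fstc : continuous (fun z : R * 'M[R]_n => z.1) by move=> z; exact: cvg_fst.
have sndc : continuous (fun z : R * 'M[R]_n => z.2) by move=> z; exact: cvg_snd.
have mulc (h k : R * 'M[R]_n -> R) : continuous h -> continuous k ->
  continuous (fun z => h z * k z) by move=> hc kc z; exact: (cvgM (hc z) (kc z)).
have cstc (U : topologicalType) (u : U) : continuous (fun _ : R * 'M[R]_n => u).
  exact: cst_continuous.
have Zc : closed Z.
  rewrite (_ : Z = ((fst @^-1` `[0, 1]) `&` (snd @^-1` Ps)) `&`
     ([set z | z.2^T = z.2] `&`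
     [set z | forall v x : 'cV[R]_n, [/\ z.1 / L * dot v v <= dot v (z.2 *m v),
        z.1 * dot v (z.2 *m v) <= dot (hess f x *m (z.2 *m v)) (z.2 *m v)
      & dot (hess f x *m (z.2 *m v)) (z.2 *m v) <= dot v (z.2 *m v)]])); last first.
    by apply/seteqP; split => z /= [] => [? ? [? ?]|[? ?] [? ?]]; split.
  apply: closedI; [apply: closedI|apply: closedI].
  - by apply: preimage_closed; [move=> z _; exact: fstc|exact: itv_closed].
  - by apply: preimage_closed => // z _; exact: sndc.
  (* Symmetry becomes a family of inequalities, one per pair of indices, so that [closed_le_fun]
     applies. *)
  - rewrite (_ : mkset _ = [set z | forall i j, z.2^T i j <= z.2 i j]).
      apply: closed_forall => i; apply: closed_forall => j.
      apply: closed_le_fun; last exact: continuous_entry sndc.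
      by under eq_fun do rewrite mxE; exact: continuous_entry sndc.
    apply/seteqP; split=> z /= => [-> //|zT]; apply/matrixP => i j.
    apply/le_anti; rewrite zT /=.
    by have := zT j i; rewrite !mxE.
  - apply: closed_forall => v; apply: closed_forall => x.
    have zvc : continuous (fun z : R * 'M[R]_n => z.2 *m v).
      apply: continuous_mulmx; [exact: sndc|exact: cstc].
    have vzvc : continuous (fun z : R * 'M[R]_n => dot v (z.2 *m v)).
      apply: continuous_dot; [exact: cstc|exact: zvc].
    have Hc : continuous (fun z : R * 'M[R]_n =>
        dot (hess f x *m (z.2 *m v)) (z.2 *m v)).
      by apply: continuous_dot => //; apply: continuous_mulmx => //; exact: cstc.
    rewrite [X in closed X](_ : _ =
      [set z : R * 'M[R]_n | z.1 / L * dot v v <= dot v (z.2 *m v)] `&`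
      ([set z | z.1 * dot v (z.2 *m v) <= dot (hess f x *m (z.2 *m v)) (z.2 *m v)]
      `&` [set z | dot (hess f x *m (z.2 *m v)) (z.2 *m v) <= dot v (z.2 *m v)])).
      apply: closedI; [|apply: closedI]; apply: closed_le_fun => //.
      + by apply: (mulc) => //; [apply: (mulc) => //|]; exact: cstc.
      + exact: mulc.
    by apply/seteqP; split => z /= => [[? ? ?]|[? []]]; split.
have Zcompact : compact Z.
  have cptX : compact (`[0, 1]%classic `*` Ps : set (R * 'M[R]_n)).
    apply: compact_setX; first exact: segment_compact.
    exact: closed_diam_compact Pcl P0 PD.
  by apply: subclosed_compact Zc cptX _ => z [].
have muL : mu <= L.
  have /andP[lo hi] := hess_bounds f_diff f_smooth f_convex 0 e.
  by rewrite -(ler_pM2r e0); exact: le_trans lo hi.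
(* This pair makes the maximal [t] positive, hence invertible. *)
have ZL : Z (mu / L, (L^-1)%:M).
  split=> //=.
    rewrite in_itv /= ler_pdivrMr // mul1r muL andbT.
    by rewrite divr_ge0 // ltW.
  split=> [|v x]; first by rewrite tr_scalar_mx.
  have /andP[lo hi] := hess_bounds f_diff f_smooth f_convex x v.
  rewrite mul_scalar_mx -scalemxAr !dot_lin.
  set a := dot v v in lo hi *; set h := dot _ _ in lo hi *; set c := L^-1.
  have a0 : 0 <= a := dot_ge0 v; have c0 : 0 < c by rewrite invr_gt0.
  have cL : c * L = 1 by rewrite mulVf // gt_eqF.
  have muc : mu * c <= 1 by rewrite -cL (mulrC c) ler_pM2r.
  have cc0 : 0 < c * c by rewrite mulr_gt0.
  split.
  - have : 0 <= c * a * (1 - mu * c) by rewrite mulr_ge0 ?subr_ge0 // mulr_ge0 // ltW.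
    by lra.
  - have : c * c * (mu * a) <= c * c * h by rewrite ler_pM2l.
    by lra.
  - have : c * c * h <= c * c * (L * a) by rewrite ler_pM2l.
    rewrite (_ : c * c * (L * a) = c * L * c * a); last by ring.
    by rewrite cL mul1r mulrA.
have [z [z01 zP zpre] zmax] := compact_continuous_min (ex_intro _ _ ZL) Zcompact
  (h := fun z => - z.1) (fun z => cvgN (fstc z)).
have z0 : 0 < z.1.
  by have := zmax _ ZL; rewrite lerN2; apply: lt_le_trans; rewrite divr_gt0.
exists z.1^-1, z.2; rewrite invr_gt0 invrK; split=> //; split.
  by apply/condition_numbersP; rewrite ?invr_gt0 // invrK; exists z.2.
move=> kappa kin; have kappa0 := kin.1.
have [P PP Ppre] := (condition_numbersP Ps kappa0).1 kin.
have k0 : 0 < kappa^-1 by rewrite invr_gt0.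
rewrite -[kappa]invrK lef_pV2 ?posrE // -lerN2; apply: (zmax (_, P)); split=> //=.
(* The two Hessian bounds at [e], divided by the positive [dot e (P *m e)], give [kappa^-1 <= 1], so
   the range [[0, 1]] in [Z] excludes no feasible value. *)
rewrite in_itv /= (ltW k0) /=; have [h1 h2 h3] := Ppre.2 e 0.
rewrite -(@ler_pM2r _ (dot e (P *m e))) ?mul1r; first exact: le_trans h2 h3.
by apply: lt_le_trans h1; rewrite mulr_gt0 ?divr_gt0.
Qed.

(** The step lowers [f] by at least [q / 2], while a Polyak-Lojasiewicz inequality in the metric of
    [P] bounds [t] times the gap by [q / 2]. *)
Lemma ratio_surrogate_le P t x : 0 < t -> preconditions f L t P ->
  ~ is_minimizer f x -> ratio_surrogate f x P <= 1 - t.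
Proof.
move=> t0 [symP HP] xN; have gap := gap_gt0 mu_gt0 f_diff f_smooth f_convex xN.
rewrite /ratio_surrogate ler_pdivrMr //.
set q := dot (g x) (P *m g x).
have descent : f (x - P *m g x) <= f x - q / 2.
  have ddub s : dot (hess f (x + s *: (- (P *m g x))) *m - (P *m g x))
      (- (P *m g x)) <= q.
    rewrite mulmxN !dot_lin opprK.
    by have [] := HP (g x) (x + s *: - (P *m g x)).
  have := taylor2_ub (is_derive_objective_line f_diff x (- (P *m g x)))
    (is_derive_grad_line f_diff x (- (P *m g x)) (- (P *m g x))) ddub.
  by rewrite scale1r scale0r addr0 dotNr -/q; lra.
have Pu : P \in unitmx.
  apply: (posdef_unitmx symP (divr_gt0 t0 L_gt0)) => v.
  by have [] := HP v 0.
pose u := invmx P *m (argmin f - x).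
have uE : P *m u = argmin f - x by rewrite mulKVmx.
set r := dot u (P *m u); set s := dot (g x) (P *m u).
have ddlb a : t * r <= dot (hess f (x + a *: (P *m u)) *m (P *m u)) (P *m u).
  by have [] := HP u (x + a *: (P *m u)).
have := taylor2_lb (is_derive_objective_line f_diff x (P *m u))
    (is_derive_grad_line f_diff x (P *m u) (P *m u)) ddlb.
rewrite scale1r scale0r addr0 -/s uE (addrC x) subrK => lower.
have := (HP (g x + t *: u) 0); case=> Pge _ _.
(* Completing the square: the form of [P] at [g x + t *: u] eliminates the unknown [s] and [r] from
   the lower bound on [fstar]. *)
have : 0 <= q + 2 * t * s + t ^+ 2 * r.
  rewrite (_ : _ + _ = dot (g x + t *: u) (P *m (g x + t *: u))).
    by apply: le_trans Pge; rewrite mulr_ge0 ?dot_ge0 // ltW // divr_gt0.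
  rewrite mulmxDr -scalemxAr !dot_lin -/q -/s -/r.
  by rewrite (dot_mulmx_sym u _ symP) (dotC _ (g x)) -/s; ring.
move=> sq; have : t * (f x - fstar) <= q / 2.
  have : t * (f x + s + t * r / 2) <= t * fstar by rewrite ler_pM2l.
  by lra.
by lra.
Qed.

End OptimalPreconditioner.

(** * Projection, surrogate gradient and regret *)

Section OrthProj.
Context {R : realType} {n : nat} (Ps : set 'M[R]_n) (D : R).
Context (Ps_closed : closed Ps) (Ps0 : Ps 0).
Context (Ps_convex : convex_set (Ps : set (convex_lmodType 'M[R]_n))).
Context (Ps_diam : (diam Ps <= D%:E)%E).

Lemma convex_combination P Q a : Ps P -> Ps Q -> 0 <= a -> a <= 1 ->
  Ps (a *: P + (1 - a) *: Q).
Proof.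
move=> PP PQ a0 a1.
have := Ps_convex (Itv01 a0 a1) (mem_set PP : P \in (Ps : set (convex_lmodType _)))
  (mem_set PQ : Q \in (Ps : set (convex_lmodType _))).
by rewrite inE.
Qed.

Lemma orth_projP A : Ps (orth_proj Ps A) /\
  forall Q, Ps Q -> fnorm (A - orth_proj Ps A) <= fnorm (A - Q).
Proof.
have ex : exists Q, Ps Q /\ forall Q', Ps Q' -> fnorm (A - Q) <= fnorm (A - Q').
  have dc : continuous (fun Q : 'M[R]_n => dot (A - Q) (A - Q)).
    have sc : continuous (fun Q : 'M[R]_n => A - Q).
      by move=> Q; exact: (cvgB (cvg_cst A) (@continuous_id _ Q)).
    exact: continuous_dot.
  have [||//|Q PQ Qmin] :=
      @compact_continuous_min _ _ (fun Q : 'M[R]_n => dot (A - Q) (A - Q)) Ps.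
  - by exists 0.
  - exact: closed_diam_compact Ps_closed Ps0 Ps_diam.
  - by exists Q; split=> // Q' PQ'; rewrite ler_fnorm; exact: Qmin.
exact: (@xgetPex _ 0 [set Q | Ps Q /\
  forall Q', Ps Q' -> fnorm (A - Q) <= fnorm (A - Q')] ex).
Qed.

(** Comparing [p] with nearby points of the segment towards [Q] gives the obtuse angle condition
    [c <= 0]; expanding [A - Q] around [p] then gives the claim. *)
Lemma orth_proj_contract A Q : Ps Q ->
  dot (orth_proj Ps A - Q) (orth_proj Ps A - Q) <= dot (A - Q) (A - Q).
Proof.
move=> PQ; have [Pp pmin] := orth_projP A; set p := orth_proj Ps A in Pp pmin *.
set c := dot (A - p) (Q - p); set b := dot (Q - p) (Q - p).
have b0 : 0 <= b := dot_ge0 _.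
have var a : 0 <= a -> a <= 1 -> 0 <= a ^+ 2 * b - 2 * a * c.
  move=> a0 a1; have := pmin _ (convex_combination PQ Pp a0 a1).
  rewrite ler_fnorm (_ : A - (_ + _) = A - p - a *: (Q - p)); last first.
    apply/matrixP => i j; rewrite !mxE; ring.
  by rewrite (dot_subZ _ (Q - p)) -/c -/b; lra.
have c0 : c <= 0.
  (* The weight [k = c / (b + c)] is defined even for [b = 0], and it makes
     [k * b - 2 * c = - (1 + k) * c] negative. *)
  rewrite leNgt; apply/negP => c0; have bc : 0 < b + c by lra.
  have k0 : 0 <= c / (b + c) by rewrite divr_ge0 // ltW.
  have k1 : c / (b + c) <= 1 by rewrite ler_pdivrMr // mul1r; lra.
  have := var _ k0 k1; set k := c / (b + c).
  have kp : 0 < k by rewrite divr_gt0.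
  have kE : k * (b + c) = c by rewrite /k divfK // gt_eqF.
  rewrite (_ : _ - _ = k * (k * b - 2 * c)); last by ring.
  by rewrite pmulr_rge0 //; have := mulr_gt0 kp c0; lra.
have -> : A - Q = (A - p) - 1 *: (Q - p) by rewrite scale1r opprB addrA subrK.
rewrite dot_subZ -/c -/b -opprB dotNl dotNr opprK -/b.
by have := dot_ge0 (A - p); lra.
Qed.

End OrthProj.

(** * The surrogate as a function of the preconditioner *)

Section RatioSurrogate.
Context {R : realType} {n : nat} (f : 'cV[R]_n -> R) (L mu D : R).
Context (L_gt0 : 0 < L) (mu_gt0 : 0 < mu) (D_gt0 : 0 < D).
Context (f_diff : twice_differentiable f) (f_smooth : smooth L f).
Context (f_convex : strongly_convex mu f).

Local Notation g := (grad f).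
Local Notation fstar := (f (argmin f)).

Lemma grad_ratio_surrogate x P :
  grad (ratio_surrogate f x) P =
  - (f x - fstar)^-1 *: (g (x - P *m g x) *m (g x)^T).
Proof.
set y := x - P *m g x; set c := (f x - fstar)^-1.
apply/matrixP => i j; rewrite -[RHS]dot_delta [LHS]mxE.
set E := delta_mx i j : 'M[R]_n.
rewrite dotZl dotC dot_outer dotC mulNr -mulrN -dotNr.
suff : is_derive P E (ratio_surrogate f x) (c * dot (g y) (- (E *m g x))).
  by case.
apply: cvg_is_derive.
have /derivableP/is_derive_cvg : derivable f y (- (E *m g x)).
  exact: diff_derivable (f_diff.1 y).
rewrite derive_grad; last exact: (f_diff.1 y).
move=> /(cvgM (cvg_cst c)); apply: cvg_trans; apply: near_eq_cvg.
near=> h; rewrite /ratio_surrogate /= -/c.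
have -> : x - (h *: E + P) *m g x = h *: - (E *m g x) + y.
  by rewrite mulmxDl -scalemxAl opprD scalerN addrCA.
rewrite -/y /GRing.scale /=; ring.
Unshelve. all: by end_near. Qed.

(** The first-order convexity inequality of [f] at [y], pulled back along the affine map sending [P]
    to [x - P *m g x]. *)
Lemma ratio_surrogate_convex x P Q : ~ is_minimizer f x ->
  ratio_surrogate f x P - ratio_surrogate f x Q
    <= dot (grad (ratio_surrogate f x) P) (P - Q).
Proof.
move=> xN; have gap := gap_gt0 mu_gt0 f_diff f_smooth f_convex xN.
rewrite grad_ratio_surrogate dotZl dotC dot_outer dotC /ratio_surrogate.
rewrite -mulrBl mulrC mulNr -mulrN ler_pM2l ?invr_gt0 //.
set y := x - P *m g x.
have yQ : x - Q *m g x = y + (P - Q) *m g x.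
  by rewrite mulmxBl addrA subrK.
have /andP[lb _] := objective_bounds f_smooth f_convex y ((P - Q) *m g x).
have := dot_ge0 ((P - Q) *m g x); rewrite yQ.
set d := dot ((P - Q) *m g x) _ in lb * => d0.
have : 0 <= mu / 2 * d by rewrite mulr_ge0 // divr_ge0 // ltW.
by lra.
Qed.

(** The gradient has rank one, so its norm is a product of two gradient norms over the gap.
    [grad_sqr_le] bounds both, since smoothness limits the gap at [y] to [(1 + L * D) ^+ 2] times
    the gap at [x]. *)
Lemma grad_ratio_surrogate_le x P : ~ is_minimizer f x -> fnorm P <= D ->
  dot (grad (ratio_surrogate f x) P) (grad (ratio_surrogate f x) P)
    <= (2 * L * (1 + L * D)) ^+ 2.
Proof.
move=> xN PD; have gap := gap_gt0 mu_gt0 f_diff f_smooth f_convex xN.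
rewrite grad_ratio_surrogate; set y := x - P *m g x.
rewrite !dotZl !dotZr mulrA dot_outer outer_mulmx dotZl.
set q := dot (g x) (g x); set w := dot (g y) (g y).
set c := f x - fstar in gap *.
have q0 : 0 <= q := dot_ge0 _; have w0 : 0 <= w := dot_ge0 _.
have qc : q <= 2 * L * c := grad_sqr_le L_gt0 mu_gt0 f_diff f_smooth f_convex x.
have wy : w <= 2 * L * (f y - fstar) :=
  grad_sqr_le L_gt0 mu_gt0 f_diff f_smooth f_convex y.
have P0 : 0 <= fnorm P := fnorm_ge0 P.
have Pg : dot (P *m g x) (P *m g x) <= D ^+ 2 * q.
  apply: le_trans (dot_mulmx_le _ _) _; rewrite ler_wpM2r //.
  by rewrite -fnorm_sqr ler_sqr ?nnegrE // ltW.
have gPg : - dot (g x) (P *m g x) <= D * q.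
  rewrite -dotNr; apply: le_trans (dot_le_fnorm _ _) _.
  have -> : D * q = fnorm (g x) * (D * fnorm (g x)) by rewrite /q -fnorm_sqr; ring.
  rewrite ler_wpM2l ?fnorm_ge0 // -ler_sqr ?nnegrE ?fnorm_ge0 //.
    by rewrite exprMn !fnorm_sqr dotNl dotNr opprK.
  by rewrite mulr_ge0 ?fnorm_ge0 // ltW.
have fy : f y - fstar <= (1 + L * D) ^+ 2 * c.
  have /andP[_] := objective_bounds f_smooth f_convex x (- (P *m g x)).
  rewrite -/y !dotNr dotNl opprK => ub.
  have h1 : L * dot (P *m g x) (P *m g x) <= L * (D ^+ 2 * (2 * L * c)).
    rewrite ler_pM2l //; apply: le_trans Pg _.
    by rewrite ler_wpM2l // sqr_ge0.
  have h2 : D * q <= D * (2 * L * c) by rewrite ler_pM2l.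
  by rewrite /c in h1 h2 *; lra.
rewrite mulrNN -expr2 exprVn ler_pdivrMl ?exprn_gt0 //.
have L2 : 0 < 2 * L by rewrite mulr_gt0.
apply: le_trans (_ : (2 * L * c) * (2 * L * ((1 + L * D) ^+ 2 * c)) <= _).
  apply: ler_pM => //; apply: le_trans wy _; by rewrite ler_pM2l.
by rewrite le_eqVlt; apply/orP; left; apply/eqP; ring.
Qed.

Lemma ratio_surrogate_continuous x : continuous (ratio_surrogate f x).
Proof.
have Pc : continuous (fun P : 'M[R]_n => P *m g x).
  by apply: continuous_mulmx; [exact: continuous_id|exact: cst_continuous].
have yc (P : 'M[R]_n) : x - Q *m g x @[Q --> P] --> x - P *m g x.
  exact: (cvgB (cvg_cst x) (Pc P)).
have fc (P : 'M[R]_n) : f (x - Q *m g x) @[Q --> P] --> f (x - P *m g x).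
  exact: (cvg_comp _ _ (yc P) (differentiable_continuous (f_diff.1 (x - P *m g x)))).
by move=> P; exact: (cvgM (cvgB (fc P) (cvg_cst _)) (cvg_cst _)).
Qed.

End RatioSurrogate.

(** * Regret of the projected gradient steps and decay of the gap *)

Section Regret.
Context {R : realType} {n : nat} (f : 'cV[R]_n -> R) (L mu D eta : R).
Context (L_gt0 : 0 < L) (mu_gt0 : 0 < mu) (D_gt0 : 0 < D) (eta_gt0 : 0 < eta).
Context (f_diff : twice_differentiable f) (f_smooth : smooth L f).
Context (f_convex : strongly_convex mu f).
Context (Ps : set 'M[R]_n) (Ps_closed : closed Ps) (Ps0 : Ps 0).
Context (Ps_convex : convex_set (Ps : set (convex_lmodType 'M[R]_n))).
Context (Ps_diam : (diam Ps <= D%:E)%E).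
Context (x1 : 'cV[R]_n) (P1 : 'M[R]_n) (Ps_P1 : Ps P1).

Local Notation s k := (iter k (osgm_step f Ps eta) (x1, P1)).
Local Notation fstar := (f (argmin f)).

Lemma osgm_mem k : Ps (s k).2.
Proof.
by case: k => // k; have [] := orth_projP Ps_closed Ps0 Ps_diam
  ((s k).2 - eta *: grad (ratio_surrogate f (s k).1) (s k).2).
Qed.

Lemma osgm_ratio k :
  ratio_surrogate f (s k).1 (s k).2 = (f (s k.+1).1 - fstar) / (f (s k).1 - fstar).
Proof. by []. Qed.

(** Online gradient descent with the squared distance to the comparator [P] as potential: convexity,
    the gradient bound and the contraction of the projection control each step. *)
Lemma osgm_regret K P : Ps P ->
  (forall k, (k < K)%N -> ~ is_minimizer f (s k).1) ->
  \sum_(k < K) ratio_surrogate f (s k).1 (s k).2 <=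
    \sum_(k < K) ratio_surrogate f (s k).1 P +
    (D ^+ 2 / (2 * eta) + K%:R * (eta / 2 * (2 * L * (1 + L * D)) ^+ 2)).
Proof.
move=> PP; set G := (2 * L * (1 + L * D)) ^+ 2.
move=> sN; rewrite -lerBlDl.
(* The induction keeps the remaining potential on the right, so that the sum telescopes; it is
   dropped only at the end. *)
suff H : 2 * eta * (\sum_(k < K) ratio_surrogate f (s k).1 (s k).2 -
    \sum_(k < K) ratio_surrogate f (s k).1 P) <=
    D ^+ 2 - dot ((s K).2 - P) ((s K).2 - P) + K%:R * (eta ^+ 2 * G).
  have eta2 : 0 < 2 * eta by rewrite mulr_gt0.
  rewrite -(ler_pM2l eta2); apply: le_trans H _.
  have -> : 2 * eta * (D ^+ 2 / (2 * eta) + K%:R * (eta / 2 * G)) =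
      D ^+ 2 + K%:R * (eta ^+ 2 * G) by field; rewrite gt_eqF.
  by rewrite lerD2r gerBl dot_ge0.
elim: K sN => [|K IH] sN.
  rewrite !big_ord0 subrr mulr0 mul0r addr0 subr_ge0.
  have := fnorm_sub_le_diam Ps_diam Ps_P1 PP; rewrite -fnorm_sqr => h.
  by rewrite ler_sqr ?nnegrE ?fnorm_ge0 // ltW.
have {}IH := IH (fun k kK => sN k (ltnW kK)).
have KN := sN K (ltnSn K).
rewrite !big_ord_recr /= -natr1.
set x := (s K).1 in KN *; set Q := (s K).2 in IH *.
set gr := grad (ratio_surrogate f x) Q.
have cvx := ratio_surrogate_convex mu_gt0 f_diff f_smooth f_convex Q P KN.
have grG : dot gr gr <= G.
  apply: (grad_ratio_surrogate_le L_gt0 mu_gt0 D_gt0 f_diff f_smooth f_convex KN).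
  exact: fnorm_le_diam Ps0 Ps_diam (osgm_mem K).
have := orth_proj_contract Ps_closed Ps0 Ps_convex Ps_diam (Q - eta *: gr) PP.
rewrite [Q - _ - P]addrAC dot_subZ (dotC _ gr) => contr.
have h1 : eta * (ratio_surrogate f x Q - ratio_surrogate f x P) <=
    eta * dot gr (Q - P) by rewrite ler_pM2l.
have h2 : eta ^+ 2 * dot gr gr <= eta ^+ 2 * G.
  by rewrite ler_pM2l // exprn_gt0.
set S1 := \sum_(k < K) _ in IH *; set S2 := \sum_(k < K) _ in IH *.
rewrite -/gr; set r1 := ratio_surrogate f x Q in h1 *.
set r2 := ratio_surrogate f x P in h1 *.
set d0 := dot (Q - P) _ in IH contr.
set d1 := dot (orth_proj _ _ - P) _ in contr *.
lra.
Qed.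

Lemma osgm_gap_le K :
  (forall k, (k < K)%N -> ~ is_minimizer f (s k).1) ->
  f (s K).1 - fstar <= (f x1 - fstar) *
    expR (\sum_(k < K) ratio_surrogate f (s k).1 (s k).2 - K%:R).
Proof.
elim: K => [|K IH] sN; first by rewrite big_ord0 subrr expR0 mulr1.
have {}IH := IH (fun k kK => sN k (ltnW kK)).
have gap := gap_gt0 mu_gt0 f_diff f_smooth f_convex (sN K (ltnSn K)).
set r := ratio_surrogate f (s K).1 (s K).2.
have -> : f (s K.+1).1 - fstar = (f (s K).1 - fstar) * r.
  by rewrite /r osgm_ratio mulrC divfK // gt_eqF.
rewrite big_ord_recr -natr1 -/r.
set S := \sum_(k < K) _ in IH *.
have -> : S + r - (K%:R + 1) = (S - K%:R) + (r - 1) by ring.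
rewrite expRD mulrA.
have r0 : 0 <= r.
  rewrite /r osgm_ratio divr_ge0 ?(ltW gap) // subr_ge0.
  exact: (argmin_le mu_gt0 f_diff f_smooth f_convex).
apply: ler_pM => //; first exact: ltW.
by have := expR_ge1Dx (r - 1); lra.
Qed.

End Regret.

(** For large [K] the second argument of the minimum is the stepsize; it balances the two regret
    terms, whose sum is [D * G * Num.sqrt K%:R]. *)
Lemma stepsize_regret_le (R : realType) (L D t : R) :
  0 < L -> 0 < D -> 0 < t -> exists2 N : R, 0 < N & forall K : nat,
    N ^+ 2 <= K%:R ->
    let G := 2 * L * (1 + L * D) in let eta := osgm_stepsize L D K in
    0 < eta /\ D ^+ 2 / (2 * eta) + K%:R * (eta / 2 * G ^+ 2) <= t / 2 * K%:R.
Proof.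
move=> L0 D0 t0; pose G := 2 * L * (1 + L * D).
have LD0 : 0 < L * D by rewrite mulr_gt0.
have G0 : 0 < G by rewrite /G !mulr_gt0 //; lra.
have DG0 : 0 < D * G / t by rewrite divr_gt0 // mulr_gt0.
(* The first summand makes the regret at most [t / 2 * K%:R]; the second gives [q >= 2], which
   selects the second argument of the minimum. *)
exists (2 * (D * G / t) + 2) => [|K NK]; first by lra.
rewrite /= -/G; pose q : R := Num.sqrt K%:R.
have qN : 2 * (D * G / t) + 2 <= q.
  rewrite -ler_sqr ?nnegrE ?sqrtr_ge0 //; last by lra.
  by rewrite sqr_sqrtr ?ler0n.
have q0 : 0 < q by lra.
have qq : K%:R = q ^+ 2 by rewrite sqr_sqrtr ?ler0n.
have Gq0 : 0 < G * q by exact: mulr_gt0.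
have etaE : osgm_stepsize L D K = D / (G * q).
  rewrite /osgm_stepsize -/G -/q min_r // ler_pdivrMr //.
  rewrite mul1r mulrC ler_pdivlMr ?mulr_gt0 ?exprn_gt0 //.
  have : 0 <= L * (q - 2) by rewrite mulr_ge0 ?ltW //; lra.
  have : 0 <= L * (L * D) * (q - 2).
    by rewrite mulr_ge0 ?subr_ge0 ?mulr_ge0 ?ltW //; lra.
  have : 0 < L * q by rewrite mulr_gt0.
  by rewrite /G; lra.
rewrite etaE; split; first by rewrite divr_gt0 // mulr_gt0.
have -> : D ^+ 2 / (2 * (D / (G * q))) + K%:R * (D / (G * q) / 2 * G ^+ 2) =
    D * G / t * (t * q).
  by rewrite qq; field; rewrite !gt_eqF.
rewrite qq (_ : t / 2 * q ^+ 2 = q / 2 * (t * q)); last by ring.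
by rewrite ler_pM2r ?mulr_gt0 //; lra.
Qed.

(** Separates full runs from stopped ones; the least index is the one at which the run stops. *)
Lemma first_minimizer (R : realType) n (f : 'cV[R]_n -> R) (x : nat -> 'cV[R]_n)
    (K : nat) :
  (forall k, (k < K)%N -> ~ is_minimizer f (x k)) \/
  exists k, [/\ (k < K)%N, is_minimizer f (x k) &
    forall j, (j < k)%N -> ~ is_minimizer f (x j)].
Proof.
have [[k [kK kmin]]|none] := pselect (exists k, (k < K)%N /\ is_minimizer f (x k)).
  right; have ex : exists k, `[< is_minimizer f (x k) >] by exists k; apply/asboolP.
  have [j /asboolP jmin jmax] := ex_minnP ex.
  exists j; split=> //; first by apply: leq_ltn_trans kK; apply: jmax; exact/asboolP.
  move=> i ij imin; have := jmax i; rewrite leqNgt ij => h.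
  by case/negP: (h (asboolT imin)).
by left=> k kK kmin; apply: none; exists k.
Qed.

Theorem corollary4p1 (R : realType) :
  (forall (n : nat) (L mu D : R) (f : 'cV[R]_n -> R) (Ps : set 'M[R]_n)
      (x1 : 'cV[R]_n) (P1 : 'M[R]_n) (K : nat),
    (0 < n)%N -> 0 < L -> 0 < mu -> 0 < D ->
    twice_differentiable f -> smooth L f -> strongly_convex mu f ->
    closed Ps -> convex_set (Ps : set (convex_lmodType 'M[R]_n)) ->
    Ps 0 -> Ps (L^-1)%:M -> (diam Ps <= D%:E)%E -> Ps P1 ->
    (1 <= K)%N ->
    let x := osgm_iterate f Ps (osgm_stepsize L D K) x1 P1 in
    (forall k, (1 <= k <= K)%N -> ~ is_minimizer f (x k)) ->
    exists theta kappa : R,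
      [/\ is_min [set K%:R^-1 * \sum_(1 <= k < K.+1) ratio_surrogate f (x k) P
                    | P in Ps]
            theta,
          is_min (condition_numbers f Ps) kappa &
          theta <= 1 - 1 / kappa])
  /\
  (exists C : R, 0 < C /\
    forall (n : nat) (L mu D : R) (f : 'cV[R]_n -> R) (Ps : set 'M[R]_n)
      (x1 : 'cV[R]_n) (P1 : 'M[R]_n),
    (0 < n)%N -> 0 < L -> 0 < mu -> 0 < D ->
    twice_differentiable f -> smooth L f -> strongly_convex mu f ->
    closed Ps -> convex_set (Ps : set (convex_lmodType 'M[R]_n)) ->
    Ps 0 -> Ps (L^-1)%:M -> (diam Ps <= D%:E)%E -> Ps P1 ->
    exists kappa : R, is_min (condition_numbers f Ps) kappa /\
      exists eps0 : R, 0 < eps0 < 1 /\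
        forall (eps : R) (K : nat), 0 < eps < eps0 ->
          C * kappa * ln (1 / eps) <= K%:R ->
          exists k : nat,
            osgm_generates f Ps (osgm_stepsize L D K) x1 P1 K k /\
            f (osgm_iterate f Ps (osgm_stepsize L D K) x1 P1 k)
              <= f (argmin f) + eps).
Proof.
split.
  move=> n L mu D f Ps x1 P1 K n0 L0 mu0 D0 fd fs fc Pcl Pcv P0 PL PD PP1 K0 x xN.
  have [kappa [P [kappa0 PP Ppre kmin]]] :=
    optimal_preconditioner n0 L0 mu0 fd fs fc Pcl P0 PL PD.
  pose avg Q := K%:R^-1 * \sum_(1 <= k < K.+1) ratio_surrogate f (x k) Q.
  have avgc : continuous avg.
    have sc : continuous (fun Q => \sum_(1 <= k < K.+1) ratio_surrogate f (x k) Q).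
      by apply: continuous_sumR => k; exact: ratio_surrogate_continuous.
    by move=> Q; exact: (cvgM (cvg_cst _) (sc Q)).
  have [|Q PQ Qmin] := compact_continuous_min _ (closed_diam_compact Pcl P0 PD) avgc.
    by exists 0.
  exists (avg Q), kappa; split=> //.
    split; first by exists Q.
    by move=> _ [Q' PQ' <-]; exact: Qmin.
  apply: le_trans (Qmin _ PP) _; rewrite div1r.
  have Kr : 0 < K%:R :> R by rewrite ltr0n.
  rewrite /avg ler_pdivrMl //.
  have -> : K%:R * (1 - kappa^-1) = \sum_(1 <= k < K.+1) (1 - kappa^-1).
    by rewrite sumr_const_nat subn1 mulr_natl.
  rewrite big_nat_cond [leRHS]big_nat_cond; apply: ler_sum => k.
  rewrite andbT ltnS => kK.
  apply: (ratio_surrogate_le L0 mu0 fd fs fc _ Ppre); last exact: xN.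
  by rewrite invr_gt0.
(* The exponent will be at most [- (t * K%:R) / 2]; the factor 4 makes this at most [- 2 * l], and
   the resulting [eps ^+ 2] leaves one factor [eps] to absorb the initial gap. *)
exists 4; split; first by [].
move=> n L mu D f Ps x1 P1 n0 L0 mu0 D0 fd fs fc Pcl Pcv P0 PL PD PP1.
have [kappa [P [kappa0 PP Ppre kmin]]] :=
  optimal_preconditioner n0 L0 mu0 fd fs fc Pcl P0 PL PD.
exists kappa; split=> //; set t := kappa^-1 in Ppre.
have t0 : 0 < t by rewrite invr_gt0.
have [N N0 HN] := stepsize_regret_le L0 D0 t0.
set gap := f x1 - f (argmin f).
have gap0 : 0 <= gap by rewrite subr_ge0; exact: (argmin_le mu0 fd fs fc).
have gap1 : 0 < 1 + gap by lra.
set E := expR (- (N ^+ 2 * t / 4)).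
have E0 : 0 < E := expR_gt0 _.
have E1 : E < 1.
  by rewrite -expR0 ltr_expR oppr_lt0 divr_gt0 // mulr_gt0 // exprn_gt0.
(* Below this threshold [gap * eps <= 1], and [eps < E] forces [K] past the [N ^+ 2] required by the
   regret bound. *)
exists (E / (1 + gap)); split.
  by rewrite divr_gt0 //= ltr_pdivrMr // mul1r; lra.
move=> eps K /andP[eps0]; rewrite ltr_pdivlMr // => epsE.
rewrite div1r lnV ?posrE //; set l := - ln eps => Kl.
have eps1 : eps < 1.
  apply: le_lt_trans (lt_trans epsE E1).
  by rewrite ler_peMr ?(ltW eps0) // lerDl.
have lN : N ^+ 2 * t / 4 < l.
  rewrite ltrNr -[ltRHS]expRK ltr_ln ?posrE ?expR_gt0 //.
  by apply: le_lt_trans epsE; rewrite ler_peMr ?(ltW eps0) // lerDl.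
have tK : 4 * l <= t * K%:R.
  by rewrite -ler_pdivrMl // invrK mulrA (mulrC kappa).
have NK : N ^+ 2 <= K%:R by rewrite -(ler_pM2l t0); lra.
have [eta0 reg] := HN K NK.
set eta := osgm_stepsize L D K in eta0 reg *.
(* Numbering from 0: the point of [s k] is the iterate of index [k.+1]. *)
pose s k := iter k (osgm_step f Ps eta) (x1, P1).
have [none|[k [kK kmin' knot]]] := first_minimizer f (fun k => (s k).1) K; last first.
  exists k.+1; split.
    by split=> [|[|j] // /andP[_ jk]]; [rewrite /= ltnS ltnW | exact: knot].
  by apply: le_trans (kmin' (argmin f)) _; rewrite lerDl ltW.
exists K.+1; split.
  by split=> [|[|j] // /andP[_ jK]]; [rewrite /= leqnn | exact: none].
rewrite -lerBlDl.
apply: le_trans (osgm_gap_le mu0 fd fs fc none) _.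
have regP := osgm_regret L0 mu0 D0 eta0 fd fs fc Pcl P0 Pcv PD PP1 PP none.
have ratioP : \sum_(k < K) ratio_surrogate f (s k).1 P <= K%:R * (1 - t).
  have -> : K%:R * (1 - t) = \sum_(k < K) (1 - t).
    by rewrite sumr_const card_ord mulr_natl.
  apply: ler_sum => k _.
  exact: (ratio_surrogate_le L0 mu0 fd fs fc t0 Ppre (none k (ltn_ord k))).
(* Adding [regP] and [ratioP] bounds the exponent by [- (t * K%:R) / 2], hence by [- (2 * l)], the
   logarithm of [eps ^+ 2]. *)
apply: le_trans (_ : gap * eps ^+ 2 <= _); last first.
  have : gap * eps <= 1 by lra.
  by move=> h; rewrite expr2 mulrA ler_piMl // ltW.
apply: ler_wpM2l => //.
have -> : eps ^+ 2 = expR (- (2 * l)).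
  by rewrite mulrN opprK mulr_natl mulr2n expRD lnK ?posrE // expr2.
by rewrite ler_expR; lra.
Qed.
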